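(* Let $n > 1$ be an integer or $n=\infty$, and let $R$ be any (associative unital) ring. The class of $\mathrm{FP}_n$-flat $R$-modules is both covering and preenveloping.
   Context: $R$-module means left $R$-module. For an integer $n\ge 0$, a (left or right) module $M$ is finitely $n$-presented if there is an exact sequence $F_n\to F_{n-1}\to\cdots\to F_1\to F_0\to M\to 0$ with every $F_i$ finitely generated projective; $\mathrm{FP}_n$ is the class of finitely $n$-presented modules, and $\mathrm{FP}_\infty$ is the class of modules lying in $\mathrm{FP}_n$ for all $n\ge 0$. A left $R$-module $M$ is $\mathrm{FP}_n$-flat if $\mathrm{Tor}^R_1(F,M)=0$ for all right $R$-modules $F\in\mathrm{FP}_n$. For a class $\mathcal X$ of modules, an $\mathcal X$-precover of $M$ is a map $\varphi\colon X\to M$ with $X\in\mathcal X$ such that every map $X'\to M$ with $X'\in\mathcal X$ factors through $\varphi$; it is a cover if moreover every endomorphism $f$ of $X$ with $\varphi f=\varphi$ is an automorphism. Preenvelopes and envelopes are defined dually. $\mathcal X$ is (pre)covering, respectively (pre)enveloping, if every module has an $\mathcal X$-(pre)cover, respectively an $\mathcal X$-(pre)envelope. *)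

(* Defs.v *)
From HB Require Import structures.
From mathcomp Require Import all_boot all_algebra.
From mathcomp Require Import finmap all_classical.

Set Implicit Arguments.
Unset Strict Implicit.
Unset Printing Implicit Defensive.

Import GRing.Theory.
Local Open Scope classical_set_scope.
Local Open Scope ring_scope.

Definition is_surj (A B : Type) (f : A -> B) : Prop := forall b, exists a, f a = b.

Definition exact_at (A B C : zmodType) (f : A -> B) (g : B -> C) : Prop :=
  forall b, g b = 0 <-> exists a, f a = b.

(* Modules over S : pzRingType in MathComp are left modules, and S may be
   the zero ring.  Right R-modules are left modules over the opposite ring R^c. *)

(* The free S-module on K: finitely supported functions K -> S *)

Definition finsupp_pred (S : pzRingType) (K : Type) : {pred K -> S^o} :=
  fun f => `[< finite_set [set k | f k != 0] >].

Lemma finsupp_pred_submod (S : pzRingType) (K : Type) :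
  submod_closed (@finsupp_pred S K).
Proof.
split=> [|a f g /asboolP Ff /asboolP Fg]; apply/asboolP.
  by apply: (sub_finite_set _ (finite_set0 K)) => k /=; rewrite eqxx.
apply: (@sub_finite_set _ _ ([set k | f k != 0] `|` [set k | g k != 0])).
  move=> k /=; case: (eqVneq (f k) 0) => [fk|]; last by left.
  case: (eqVneq (g k) 0) => [gk|]; last by right.
  by rewrite addrfctE scalrfctE fk gk scaler0 addr0 eqxx.
by rewrite finite_setU.
Qed.

HB.instance Definition _ (S : pzRingType) (K : Type) :=
  GRing.isSubmodClosed.Build S (K -> S^o) (@finsupp_pred S K)
    (@finsupp_pred_submod S K).

Record freemod (S : pzRingType) (K : Type) := FreeMod {
  fm_val : K -> S^o;
  fm_valP : fm_val \in @finsupp_pred S K }.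

HB.instance Definition _ (S : pzRingType) (K : Type) :=
  [isSub for @fm_val S K].
HB.instance Definition _ (S : pzRingType) (K : Type) :=
  [Choice of freemod S K by <:].
HB.instance Definition _ (S : pzRingType) (K : Type) :=
  [SubChoice_isSubLmodule of freemod S K by <:].

Section FreeModuleTheory.
Variables (S : pzRingType) (K : choiceType).
Implicit Types (k : K) (x y : freemod S K).

Lemma fm_finite x : finite_set [set k | fm_val x k != 0].
Proof. exact/asboolP/(fm_valP x). Qed.

Lemma fm_delta_subproof k :
  (fun j => (j == k)%:R : S^o) \in @finsupp_pred S K.
Proof.
apply/asboolP/(sub_finite_set _ (finite_set1 k)) => j /=.
by case: (eqVneq j k) => // _; rewrite eqxx.
Qed.

Definition fm_delta k : freemod S K := FreeMod (fm_delta_subproof k).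

Variables (V : lmodType S) (f : K -> V).

(* The linear map with fm_delta k |-> f k *)
Definition fm_lift (x : freemod S K) : V :=
  \sum_(k \in [set: K]) (fm_val x k : S) *: f k.

Lemma fm_liftE (A : {fset K}) x :
    [set k | fm_val x k != 0] `<=` [set` A] ->
  fm_lift x = \sum_(k <- A) (fm_val x k : S) *: f k.
Proof.
move=> sA; apply: fsbigTE => k kA.
have [->|/sA/= kA'] := eqVneq (fm_val x k) 0; first by rewrite scale0r.
by rewrite kA' in kA.
Qed.

Lemma fm_lift_is_linear : linear fm_lift.
Proof.
move=> a x y.
pose A := fset_set ([set k | fm_val x k != 0] `|` [set k | fm_val y k != 0]).
have sA k : (fm_val x k != 0) || (fm_val y k != 0) -> k \in A.
  move=> h; rewrite in_fset_set ?finite_setU; last by split; exact: fm_finite.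
  by apply/mem_set; case/orP: h; [left|right].
have [sx sy] : [set k | fm_val x k != 0] `<=` [set` A] /\
               [set k | fm_val y k != 0] `<=` [set` A].
  by split=> k /= h; apply: sA; rewrite h ?orbT.
rewrite (fm_liftE sx) (fm_liftE sy) (@fm_liftE A).
  rewrite scaler_sumr -big_split /=; apply: eq_bigr => k _.
  by rewrite scalerA -scalerDl.
move=> k /= h; apply: sA; apply: contraNT h; rewrite negb_or !negbK.
case/andP=> /eqP x0 /eqP y0.
by rewrite [X in X == 0](_ : _ = a *: fm_val x k + fm_val y k) // x0 y0 scaler0 addr0.
Qed.

HB.instance Definition _ :=
  GRing.isLinear.Build S (freemod S K) V *:%R fm_lift fm_lift_is_linear.

Lemma fm_lift_delta k : fm_lift (fm_delta k) = f k.
Proof.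
rewrite (@fm_liftE [fset k]%fset) ?big_seq_fset1 /= ?eqxx ?scale1r //.
by move=> j /=; rewrite inE; case: (j == k); rewrite ?eqxx.
Qed.

End FreeModuleTheory.

Definition ker_pred (A B : zmodType) (f : A -> B) : {pred A} :=
  fun x => f x == 0.

Lemma ker_pred_zmod (A B : zmodType) (f : {additive A -> B}) :
  zmod_closed (ker_pred f).
Proof.
split=> [|x y]; rewrite /ker_pred !unfold_in /=; first by rewrite raddf0.
by move=> /eqP fx /eqP fy; rewrite raddfB fx fy subr0.
Qed.

HB.instance Definition _ (A B : zmodType) (f : {additive A -> B}) :=
  GRing.isZmodClosed.Build A (ker_pred f) (ker_pred_zmod f).

Lemma ker_pred_scale (S : pzRingType) (A B : lmodType S)
  (f : {linear A -> B}) : scaler_closed (ker_pred f).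
Proof.
move=> a x; rewrite /ker_pred !unfold_in /= => /eqP fx.
by rewrite linearZ_LR fx scaler0.
Qed.

HB.instance Definition _ (S : pzRingType) (A B : lmodType S)
    (f : {linear A -> B}) :=
  GRing.isScaleClosed.Build S A (ker_pred f) (@ker_pred_scale S A B f).

Record ker (A B : zmodType) (f : A -> B) := Ker {
  ker_val : A;
  ker_valP : ker_val \in ker_pred f }.

HB.instance Definition _ (A B : zmodType) (f : A -> B) :=
  [isSub for @ker_val A B f].
HB.instance Definition _ (A B : zmodType) (f : A -> B) :=
  [Choice of ker f by <:].
HB.instance Definition _ (A B : zmodType) (f : {additive A -> B}) :=
  [SubChoice_isSubZmodule of ker f by <:].
HB.instance Definition _ (S : pzRingType) (A B : lmodType S)
    (f : {linear A -> B}) :=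
  [SubZmodule_isSubLmodule of ker f by <:].

Definition ker_incl (S : pzRingType) (A B : lmodType S)
  (f : {linear A -> B}) : {linear ker f -> A} := val.

Definition boundary_pred (A B C : zmodType) (f : {additive A -> B})
  (g : {additive B -> C}) : {pred ker g} := fun z => `[< exists a, f a = val z >].

Lemma boundary_pred_zmod (A B C : zmodType) (f : {additive A -> B})
  (g : {additive B -> C}) : zmod_closed (boundary_pred f (g := g)).
Proof.
split=> [|x y /asboolP[a fa] /asboolP[b fb]]; apply/asboolP.
  by exists 0; rewrite raddf0.
by exists (a - b); rewrite raddfB fa fb.
Qed.

HB.instance Definition _ (A B C : zmodType) (f : {additive A -> B})
    (g : {additive B -> C}) :=
  GRing.isZmodClosed.Build (ker g) (boundary_pred f (g := g))
    (boundary_pred_zmod f g).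

(* ker g / (im f :&: ker g), the homology at B of A -f-> B -g-> C *)
Definition homology (A B C : zmodType) (f : {additive A -> B})
    (g : {additive B -> C}) : zmodType :=
  @Quotient.quot (ker g) (boundary_pred f (g := g)).

Definition gen_zmod_pred (V : zmodType) (X : set V) : {pred V} :=
  fun x => `[< forall G : zmodClosed V, (forall y, X y -> y \in G) -> x \in G >].

Lemma gen_zmod_pred_zmod (V : zmodType) (X : set V) :
  zmod_closed (gen_zmod_pred X).
Proof.
split=> [|x y /asboolP hx /asboolP hy]; apply/asboolP => G XG.
  exact: rpred0.
by apply: rpredB; [exact: hx|exact: hy].
Qed.

HB.instance Definition _ (V : zmodType) (X : set V) :=
  GRing.isZmodClosed.Build V (gen_zmod_pred X) (gen_zmod_pred_zmod X).

Section Tensor.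
Variable R : pzRingType.

(* The right action u . r is r *: u for the R^c-module structure. *)
Inductive tensor_rel (F : lmodType R^c) (M : lmodType R) :
    set (freemod int (F * M)%type) :=
| TensorAddl u v m : tensor_rel
    (fm_delta int (u + v, m) - (fm_delta int (u, m) + fm_delta int (v, m)))
| TensorAddr u m p : tensor_rel
    (fm_delta int (u, m + p) - (fm_delta int (u, m) + fm_delta int (u, p)))
| TensorBal u (r : R) m : tensor_rel
    (fm_delta int ((r : R^c) *: u, m) - fm_delta int (u, r *: m)).

Definition tensor (F : lmodType R^c) (M : lmodType R) : zmodType :=
  @Quotient.quot (freemod int (F * M)%type) (gen_zmod_pred (@tensor_rel F M)).

Definition pure_tensor (F : lmodType R^c) (M : lmodType R) (u : F) (m : M) :
  tensor F M := \pi_(tensor F M)%qT (fm_delta int (u, m)).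

Section TensorMap.
Variables (F F' : lmodType R^c) (f : {linear F -> F'}) (M : lmodType R).

Definition tensor_map_free : {additive freemod int (F * M)%type -> tensor F' M} :=
  \pi_(tensor F' M)%qT \o
  fm_lift (fun p : (F * M)%type => fm_delta int (f p.1, p.2)).

Lemma tensor_map_free_delta u m :
  tensor_map_free (fm_delta int (u, m)) = pure_tensor (f u) m.
Proof. by rewrite /tensor_map_free /= fm_lift_delta. Qed.

Lemma pi_tensor_eq0 (x : freemod int (F' * M)%type) :
  tensor_rel x -> \pi_(tensor F' M)%qT x = 0.
Proof.
move=> rx; rewrite -(raddf0 \pi_(tensor F' M)%qT); apply/eqP.
rewrite -Quotient.idealrBE subr0; apply/asboolP => G; exact.
Qed.

Lemma tensor_map_free_rel (x : freemod int (F * M)%type) :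
  x \in gen_zmod_pred (@tensor_rel F M) -> tensor_map_free x = 0.
Proof.
move=> /asboolP/(_ (ker_pred tensor_map_free)) hx; apply/eqP; apply: hx => y hy.
apply/eqP/pi_tensor_eq0; case: hy => [u v m|u m p|u r m].
- by rewrite /= raddfB raddfD /= !fm_lift_delta /= linearD; exact: TensorAddl.
- by rewrite /= raddfB raddfD /= !fm_lift_delta /=; exact: TensorAddr.
by rewrite /= raddfB /= !fm_lift_delta /= linearZ_LR; exact: TensorBal.
Qed.

Definition tensor_map (z : tensor F M) : tensor F' M := tensor_map_free (repr z).

Lemma tensor_map_pi (x : freemod int (F * M)%type) :
  tensor_map (\pi_(tensor F M)%qT x) = tensor_map_free x.
Proof.
apply/eqP; rewrite -subr_eq0 -raddfB; apply/eqP/tensor_map_free_rel.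
by rewrite Quotient.idealrBE reprK.
Qed.

Lemma tensor_map_is_additive : zmod_morphism tensor_map.
Proof.
move=> x y; rewrite -[x]reprK -[y]reprK -raddfB !tensor_map_pi.
exact: raddfB.
Qed.

HB.instance Definition _ :=
  GRing.isZmodMorphism.Build (tensor F M) (tensor F' M) tensor_map
    tensor_map_is_additive.

Lemma tensor_map_pure u m :
  tensor_map (pure_tensor u m) = pure_tensor (f u) m.
Proof. by rewrite tensor_map_pi tensor_map_free_delta. Qed.

End TensorMap.

End Tensor.

Arguments tensor_map {R F F'} f M z.

(* Tor_1 is computed with the free resolution of F in which the i-th term is the
   free module on the underlying set of the i-th syzygy of F.  By the comparison
   theorem any other projective resolution of F gives an isomorphic group. *)

Section FreeResolution.
Variable S : pzRingType.

Definition fm_cover (F : lmodType S) : {linear freemod S F -> F} := fm_lift id.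

Fixpoint syzygy (F : lmodType S) (i : nat) : lmodType S :=
  if i is j.+1 then ker (fm_cover (syzygy F j)) else F.

Definition free_res (F : lmodType S) (i : nat) : lmodType S :=
  freemod S (syzygy F i).

Definition free_res_d (F : lmodType S) (i : nat) :
    {linear free_res F i.+1 -> free_res F i} :=
  ker_incl (fm_cover (syzygy F i)) \o fm_cover (syzygy F i.+1).

End FreeResolution.

Definition Tor1 (R : pzRingType) (F : lmodType R^c) (M : lmodType R) : zmodType :=
  homology (tensor_map (free_res_d F 1) M) (tensor_map (free_res_d F 0) M).

Definition fin_gen (S : pzRingType) (M : lmodType S) : Prop :=
  exists k (g : 'I_k -> M), forall x, exists c : 'I_k -> S,
    x = \sum_(i < k) c i *: g i.

Definition projective (S : pzRingType) (P : lmodType S) : Prop :=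
  forall (A B : lmodType S) (g : {linear A -> B}) (h : {linear P -> B}),
    is_surj g -> exists k : {linear P -> A}, forall x, g (k x) = h x.

(* Only the terms F i with i <= n of the sequence F matter. *)
Definition fin_presented (S : pzRingType) (n : nat) (M : lmodType S) : Prop :=
  exists (F : nat -> lmodType S) (d : forall i, {linear F i.+1 -> F i})
         (e : {linear F 0%N -> M}),
    [/\ forall i, (i <= n)%N -> fin_gen (F i) /\ projective (F i),
        is_surj e,
        (0 < n)%N -> exact_at (d 0%N) e
      & forall i, (i.+1 < n)%N -> exact_at (d i.+1) (d i)].

(* The index n of FP_n: a natural number or infinity *)
Variant level := LFin of nat | LInfty.

Definition level_gt1 (n : level) : bool := if n is LFin k then (1 < k)%N else true.

Definition FP (S : pzRingType) (n : level) (M : lmodType S) : Prop :=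
  match n with
  | LFin k => fin_presented k M
  | LInfty => forall k, fin_presented k M
  end.

Definition FP_flat (R : pzRingType) (n : level) (M : lmodType R) : Prop :=
  forall F : lmodType R^c, FP n F -> forall t : Tor1 F M, t = 0.

Section Approximations.
Variables (R : pzRingType) (X : lmodType R -> Prop).

Definition is_precover (M C : lmodType R) (phi : {linear C -> M}) : Prop :=
  X C /\ forall (C' : lmodType R) (psi : {linear C' -> M}), X C' ->
    exists h : {linear C' -> C}, forall x, phi (h x) = psi x.

Definition is_cover (M C : lmodType R) (phi : {linear C -> M}) : Prop :=
  is_precover phi /\
  forall f : {linear C -> C}, (forall x, phi (f x) = phi x) -> bijective f.

Definition is_preenvelope (M E : lmodType R) (phi : {linear M -> E}) : Prop :=
  X E /\ forall (E' : lmodType R) (psi : {linear M -> E'}), X E' ->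
    exists h : {linear E -> E'}, forall x, h (phi x) = psi x.

Definition covering : Prop :=
  forall M : lmodType R, exists (C : lmodType R) (phi : {linear C -> M}), is_cover phi.

Definition preenveloping : Prop :=
  forall M : lmodType R,
    exists (E : lmodType R) (phi : {linear M -> E}), is_preenvelope phi.

End Approximations.

(* Main.v *)
From HB Require Import structures.
Require Import Defs.
From mathcomp Require Import all_boot all_algebra.
From mathcomp Require Import finmap all_classical.

(* For n > 1 a module F in FP_n has a resolution whose terms P_2 -> P_1 -> P_0 are
   finitely generated projective, and dual bases turn Tor_1(F, M) = 0 into one
   implication "c x = 0 => exists y, x = s y" between finite systems of linear
   equations in M.  So the FP_n-flat modules form a class X axiomatised by a set
   of such implications.

   Preenvelopes.  The image of a map M -> N with N in X lies in the closure of that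
   image under module operations and chosen solutions y.  This closure is in X and
   is a quotient of a free module depending on M only, so the product of all such
   quotients over M is a preenvelope.

   Precovers.  Given C -> M with C in X, Zorn's lemma gives a largest quotient map
   C -> C/P over M with C/P in X.  Suppose 0 is the only such P for C.  Let D be a
   pure submodule of C containing a copy of every small tuple of C with prescribed
   entries in D and prescribed image in M.  If D + T is pure in C for a small T,
   the copy of T in D gives a retraction D + T -> D over M, whose kernel is pure in
   C, hence zero; thus D = C.  As D is generated from nothing by boundedly many
   operations, C is bounded in terms of M, and the direct sum of all bounded C -> M
   is a precover.

   Covers.  X is closed under directed unions of presentations.  Zorn's lemma,
   applied to presentations extending a precover, makes all its maps over M to
   modules of X injective; applied again to extensions of such a precover, it makes
   all its endomorphisms over M surjective, by a cardinality argument. *)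

Set Implicit Arguments.
Unset Strict Implicit.
Unset Printing Implicit Defensive.

Import GRing.Theory.
Local Open Scope classical_set_scope.
Local Open Scope ring_scope.

(** * Submodules and quotient modules *)

Lemma linear_ex (R : pzRingType) (A B : lmodType R) (f : A -> B) :
  linear f -> exists g : {linear A -> B}, forall x, g x = f x.
Proof.
move=> fL; pose m := GRing.isLinear.Build R A B *:%R f fL.
by pose g : {linear A -> B} := HB.pack f m; exists g.
Qed.

Lemma linear_sumZ (R : pzRingType) (A B : lmodType R) (f : {linear A -> B})
    n (c : nat -> R) (x : nat -> A) :
  f (\sum_(i < n) c i *: x i) = \sum_(i < n) c i *: f (x i).
Proof. by rewrite linear_sum; apply: eq_bigr => i _; rewrite linearZ. Qed.

Section Submodules.
Variables (R : pzRingType) (V : lmodType R).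

Record submod := Submod {
  sm :> V -> Prop;
  sm0 : sm 0;
  sm_lin : forall a x y, sm x -> sm y -> sm (a *: x + y) }.

Variable U : submod.

Lemma smD x y : U x -> U y -> U (x + y).
Proof. by move=> Ux Uy; rewrite -[x]scale1r; exact: sm_lin. Qed.

Lemma smZ a x : U x -> U (a *: x).
Proof. by move=> Ux; rewrite -[_ *: _]addr0; apply: sm_lin (sm0 _). Qed.

Lemma smN x : U x -> U (- x).
Proof. by rewrite -scaleN1r; exact: smZ. Qed.

Lemma smB x y : U x -> U y -> U (x - y).
Proof. by move=> Ux Uy; rewrite addrC -scaleN1r; exact: sm_lin. Qed.

Lemma sm_sum (I : eqType) (r : seq I) (F : I -> V) :
  (forall i, i \in r -> U (F i)) -> U (\sum_(i <- r) F i).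
Proof.
by move=> UF; rewrite big_seq; elim/big_ind: _ => //; [exact: sm0|exact: smD].
Qed.

Lemma sm_sumZ n (c : nat -> R) (x : nat -> V) :
  (forall i, (i < n)%N -> U (x i)) -> U (\sum_(i < n) c i *: x i).
Proof. by move=> Ux; apply: sm_sum => i _; apply/smZ/Ux/ltn_ord. Qed.

Definition sm_pred : {pred V} := fun x => `[< U x >].

Lemma sm_pred_zmod : zmod_closed sm_pred.
Proof.
split=> [|x y /asboolP Ux /asboolP Uy]; apply/asboolP; first exact: sm0.
exact: smB.
Qed.

HB.instance Definition _ := GRing.isZmodClosed.Build V sm_pred sm_pred_zmod.

Definition lquot := @Quotient.quot V sm_pred.
HB.instance Definition _ := Choice.on lquot.
HB.instance Definition _ := GRing.Zmodule.on lquot.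

Definition lquot_pi (x : V) : lquot := \pi_(lquot)%qT x.

Lemma lquot_pi_eq x y : lquot_pi x = lquot_pi y <-> U (x - y).
Proof.
rewrite /lquot_pi; split=> [/eqP|Uxy].
  by rewrite -Quotient.idealrBE => /asboolP.
by apply/eqP; rewrite -Quotient.idealrBE; apply/asboolP.
Qed.

Lemma lquot_surj (q : lquot) : exists x, lquot_pi x = q.
Proof. by exists (repr q); rewrite /lquot_pi reprK. Qed.

Definition lquot_scale (a : R) (q : lquot) : lquot := lquot_pi (a *: repr q).

Lemma lquot_scale_pi a x : lquot_scale a (lquot_pi x) = lquot_pi (a *: x).
Proof.
apply/lquot_pi_eq; rewrite -scalerBr; apply: smZ; apply/lquot_pi_eq.
by rewrite /lquot_pi reprK.
Qed.

Lemma lquot_piD x y : lquot_pi (x + y) = lquot_pi x + lquot_pi y.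
Proof. by rewrite /lquot_pi raddfD. Qed.

Lemma lquot_scalerA a b v : lquot_scale a (lquot_scale b v) = lquot_scale (a * b) v.
Proof. by have [x <-] := lquot_surj v; rewrite !lquot_scale_pi scalerA. Qed.

Lemma lquot_scale1r : left_id 1 lquot_scale.
Proof. by move=> v; have [x <-] := lquot_surj v; rewrite lquot_scale_pi scale1r. Qed.

Lemma lquot_scalerDr : right_distributive lquot_scale +%R.
Proof.
move=> a u v; have [x <-] := lquot_surj u; have [y <-] := lquot_surj v.
by rewrite -lquot_piD !lquot_scale_pi scalerDr lquot_piD.
Qed.

Lemma lquot_scalerDl v : {morph lquot_scale^~ v : a b / a + b}.
Proof.
move=> a b; have [x <-] := lquot_surj v.
by rewrite !lquot_scale_pi scalerDl lquot_piD.
Qed.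

HB.instance Definition _ := GRing.Zmodule_isLmodule.Build R lquot
  lquot_scalerA lquot_scale1r lquot_scalerDr lquot_scalerDl.

Lemma lquot_pi_is_linear : linear lquot_pi.
Proof. by move=> a x y; rewrite lquot_piD -lquot_scale_pi. Qed.

HB.instance Definition _ :=
  GRing.isLinear.Build R V lquot *:%R lquot_pi lquot_pi_is_linear.

Lemma lquot_pi_eq0 x : lquot_pi x = 0 <-> U x.
Proof. by rewrite -(linear0 lquot_pi) lquot_pi_eq subr0. Qed.

End Submodules.

Arguments sm_lin {R V} s {a x y}.

Section SubmoduleConstructions.
Variables (R : pzRingType).

Definition sm_full (V : lmodType R) : submod V := @Submod R V (fun=> True) I (fun _ _ _ _ _ => I).

Lemma sm_zero_lin (V : lmodType R) (a : R) (x y : V) : x = 0 -> y = 0 -> a *: x + y = 0.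
Proof. by move=> -> ->; rewrite scaler0 addr0. Qed.

Definition sm_zero (V : lmodType R) : submod V :=
  @Submod R V (fun x => x = 0) erefl (@sm_zero_lin V).

Lemma preim_lin (V W : lmodType R) (f : {linear V -> W}) (U : submod W) a x y :
  U (f x) -> U (f y) -> U (f (a *: x + y)).
Proof. by move=> Ux Uy; rewrite linearP; exact: sm_lin. Qed.

Lemma preim0 (V W : lmodType R) (f : {linear V -> W}) (U : submod W) : U (f 0).
Proof. by rewrite linear0; exact: sm0. Qed.

Definition sm_preim (V W : lmodType R) (f : {linear V -> W}) (U : submod W) : submod V :=
  @Submod R V (fun x => U (f x)) (preim0 f U) (@preim_lin V W f U).

Definition sm_ker (V W : lmodType R) (f : {linear V -> W}) := sm_preim f (sm_zero W).

Lemma setI_lin (V : lmodType R) (N U : submod V) a (x y : V) :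
  N x /\ U x -> N y /\ U y -> N (a *: x + y) /\ U (a *: x + y).
Proof. by move=> [Nx Ux] [Ny Uy]; split; exact: sm_lin. Qed.

Definition sm_cap (V : lmodType R) (N U : submod V) : submod V :=
  @Submod R V (fun x => N x /\ U x) (conj (sm0 N) (sm0 U)) (@setI_lin V N U).

(* A linear map on B is defined through a family of representatives a |-> L a
   of the elements of B modulo P. *)
Lemma linear_factor (A B D : lmodType R) (L : {linear A -> B}) (P : submod B)
    (G : {linear A -> D}) :
  (forall b, exists a, P (L a - b)) -> (forall a, P (L a) -> G a = 0) ->
  exists h : {linear B -> D}, forall a b, P (L a - b) -> h b = G a.
Proof.
move=> Lsurj LG; have [s sP] := choice Lsurj.
have sE a b : P (L a - b) -> G (s b) = G a.
  move=> Pab; apply/eqP; rewrite -subr_eq0 -linearB; apply/eqP/LG.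
  have -> : L (s b - a) = (L (s b) - b) - (L a - b) by rewrite linearB opprB addrA subrK.
  exact: smB.
have [|h hE] := @linear_ex R B D (fun b => G (s b)).
  move=> c x y; rewrite -linearP; apply: sE; rewrite linearP.
  rewrite opprD addrACA -scalerBr; exact: sm_lin.
by exists h => a b Pab; rewrite hE; exact: sE.
Qed.

End SubmoduleConstructions.

(** * Definable classes and hulls *)

Section FreeModules.
Variables (R : pzRingType) (K : choiceType).
Implicit Types (x : freemod R K) (V W : lmodType R).

Lemma fm_expand x : exists A : {fset K},
  (forall k, (k \in A) = (fm_val x k != 0)) /\ x = \sum_(k <- A) (fm_val x k : R) *: fm_delta R k.
Proof.
pose A := fset_set [set k | fm_val x k != 0].
have inA k : (k \in A) = (fm_val x k != 0).
  by rewrite in_fset_set; [apply/idP/idP => [/set_mem|/mem_set]|exact: fm_finite].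
exists A; split=> //.
apply: val_inj; rewrite raddf_sum /=; apply/funext => j.
rewrite fct_sumE (eq_bigr (fun k => if k == j then fm_val x k else 0 : R^o)); last first.
  move=> k _; rewrite [LHS](_ : _ = fm_val x k * (j == k)%:R) //.
  by rewrite eq_sym; case: ifP => _; rewrite ?mulr1 ?mulr0.
rewrite -big_mkcond /=; have [jA|jA] := boolP (j \in A).
  by rewrite (fbig_pred1_inj _ _ jA (@inj_id _)).
rewrite big_seq_cond big_pred0 => [|k].
  by apply/eqP; rewrite inA negbK in jA.
by apply/negP => /andP[kA /eqP kj]; rewrite -kj kA in jA.
Qed.

Lemma fm_supp_eq V (G H : {linear freemod R K -> V}) x :
  (forall k, fm_val x k != 0 -> G (fm_delta R k) = H (fm_delta R k)) -> G x = H x.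
Proof.
have [A [sA xE]] := fm_expand x => GH; rewrite {1}xE [in RHS]xE !linear_sum.
by apply: eq_big_seq => k; rewrite sA => /GH; rewrite !linearZ => ->.
Qed.

Lemma fm_ext V (G H : {linear freemod R K -> V}) :
  (forall k, G (fm_delta R k) = H (fm_delta R k)) -> G =1 H.
Proof. by move=> GH x; apply: fm_supp_eq => k _; exact: GH. Qed.

Lemma fm_lift_comp V W (f : {linear V -> W}) (g : K -> V) x :
  fm_lift (f \o g) x = f (fm_lift g x).
Proof.
have := @fm_ext W (fm_lift (f \o g)) (f \o fm_lift g); apply => k.
by rewrite /= !fm_lift_delta.
Qed.

Lemma fm_span (U : submod (freemod R K)) x :
  (forall k, fm_val x k != 0 -> U (fm_delta R k)) -> U x.
Proof.
have [A [sA xE]] := fm_expand x => Ux; rewrite xE; apply: sm_sum => k.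
by rewrite sA => /Ux; exact: smZ.
Qed.

End FreeModules.

(** Conditions are collected one at a time, passing to the larger of two comparable members. This
    finiteness is what makes implications between finite systems survive unions of chains. *)
Lemma chain_bound (T : Type) (le : T -> T -> Prop) (A : set T) (s0 : T)
    (P : nat -> T -> Prop) n :
  (forall s t, A s -> A t -> le s t \/ le t s) -> A s0 ->
  (forall i s t, le s t -> P i s -> P i t) ->
  (forall i, (i < n)%N -> exists2 s, A s & P i s) ->
  exists2 s, A s & forall i, (i < n)%N -> P i s.
Proof.
move=> Atot As0 Pmono; elim: n => [|n IH] Pex; first by exists s0.
have [i /ltnW/Pex//|s As Ps] := IH; have [t At Pt] := Pex n (leqnn _).
have [st|ts] := Atot s t As At.
  exists t => // i; rewrite ltnS leq_eqVlt => /predU1P[->//|/Ps]; exact: Pmono.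
exists s => // i; rewrite ltnS leq_eqVlt => /predU1P[->|/Ps//]; exact: Pmono Pt.
Qed.

Lemma chain_submod (R : pzRingType) (V : lmodType R) (T : Type) (le : T -> T -> Prop)
    (A : set T) (t0 : T) (N : T -> submod V) :
  (forall s t, A s -> A t -> le s t \/ le t s) -> A t0 ->
  (forall s t x, le s t -> N s x -> N t x) ->
  exists S : submod V, forall x, S x <-> exists2 t, A t & N t x.
Proof.
move=> Atot At0 Nmono; pose S x := exists2 t, A t & N t x.
have S0 : S 0 by exists t0 => //; exact: sm0.
have Slin a x y : S x -> S y -> S (a *: x + y).
  move=> [s As Nx] [t At Ny]; have [st|ts] := Atot s t As At.
    by exists t => //; apply: sm_lin => //; exact: Nmono st _.
  by exists s => //; apply: sm_lin => //; exact: Nmono ts _.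
by exists (Submod S0 Slin).
Qed.

(* The implication: c x = 0 => exists y, x = s y, for finite tuples x and y of
   elements of a module.  A set of such implications is a definable class. *)
Record ppsys (R : pzRingType) := PPsys {
  pp_nx : nat; pp_nc : nat; pp_ny : nat;
  pp_c : nat -> nat -> R;
  pp_s : nat -> nat -> R }.

Section Definable.
Variable R : pzRingType.
Implicit Types (s : ppsys R) (Sg : set (ppsys R)) (V W : lmodType R).

Definition pp_lhs V s (x : nat -> V) (j : nat) : V :=
  \sum_(i < pp_nx s) pp_c s j i *: x i.

Definition pp_rhs V s (y : nat -> V) (i : nat) : V :=
  \sum_(l < pp_ny s) pp_s s i l *: y l.

(** Stated for predicates on a fixed ambient module, so that subquotients need not be formed and
    unions of chains can be handled before they are known to be submodules. *)
Definition solv V (N U : V -> Prop) s := forall x : nat -> V,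
  (forall i, (i < pp_nx s)%N -> N (x i)) ->
  (forall j, (j < pp_nc s)%N -> U (pp_lhs s x j)) ->
  exists2 y : nat -> V, forall l, (l < pp_ny s)%N -> N (y l)
    & forall i, (i < pp_nx s)%N -> U (x i - pp_rhs s y i).

(* N / (N :&: U) is in the definable class of Sg *)
Definition solves Sg V (N U : V -> Prop) := forall s, Sg s -> solv N U s.

Definition definable Sg V := solves Sg (sm_full V) (sm_zero V).

Lemma pp_lhs_linear V W (f : {linear V -> W}) s x j :
  f (pp_lhs s x j) = pp_lhs s (f \o x) j.
Proof. exact: linear_sumZ. Qed.

Lemma pp_rhs_linear V W (f : {linear V -> W}) s x j :
  f (pp_rhs s x j) = pp_rhs s (f \o x) j.
Proof. exact: linear_sumZ. Qed.

Lemma pp_lhsB V s (x y : nat -> V) j :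
  pp_lhs s (fun i => x i - y i) j = pp_lhs s x j - pp_lhs s y j.
Proof. by rewrite -sumrB; apply: eq_bigr => i _; rewrite scalerBr. Qed.

Lemma pp_rhsB V s (x y : nat -> V) j :
  pp_rhs s (fun i => x i - y i) j = pp_rhs s x j - pp_rhs s y j.
Proof. by rewrite -sumrB; apply: eq_bigr => i _; rewrite scalerBr. Qed.

Lemma sm_lhs V (U : submod V) s x j :
  (forall i, (i < pp_nx s)%N -> U (x i)) -> U (pp_lhs s x j).
Proof. exact: sm_sumZ. Qed.

Lemma sm_rhs V (U : submod V) s x j :
  (forall i, (i < pp_ny s)%N -> U (x i)) -> U (pp_rhs s x j).
Proof. exact: sm_sumZ. Qed.

(** The hypotheses say that [L] induces an isomorphism from [N / (N :&: U)] onto [N' / (N' :&: U')];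
    solutions are carried across it in both directions. *)
Lemma solv_transfer V W (L : {linear V -> W}) (N U : submod V) (N' U' : submod W) s :
  (forall a, N a -> N' (L a)) ->
  (forall b, N' b -> exists2 a, N a & U' (L a - b)) ->
  (forall a, N a -> U a <-> U' (L a)) ->
  solv N U s <-> solv N' U' s.
Proof.
move=> LN Lsurj LU.
have lift n (x' : nat -> W) : (forall i, (i < n)%N -> N' (x' i)) ->
    exists x, forall i, (i < n)%N -> N (x i) /\ U' (L (x i) - x' i).
  move=> Nx'; have /choice : forall i, exists a,
    (i < n)%N -> N a /\ U' (L a - x' i); last by case=> x; exists x.
  move=> i; case: (ltnP i n) => [/Nx'/Lsurj[a Na Ua]|_]; first by exists a.
  by exists 0.
split=> [sol x' Nx' Ux'|sol x Nx Ux].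
  have [x xP] := lift _ _ Nx'.
  have [i /xP[]//|j jn|y Ny Uy] := sol x.
    apply/LU; first by apply: sm_lhs => i /xP[].
    have -> : L (pp_lhs s x j) = pp_lhs s (fun i => (L \o x) i - x' i) j + pp_lhs s x' j.
      by rewrite pp_lhsB subrK pp_lhs_linear.
    by apply: smD; [apply: sm_lhs => i /xP[]|exact: Ux'].
  exists (L \o y) => [l /Ny/LN//|i ilt].
  have -> : x' i - pp_rhs s (L \o y) i = L (x i - pp_rhs s y i) - (L (x i) - x' i).
    by rewrite linearB -pp_rhs_linear opprB [RHS]addrC addrA subrK.
  apply: smB; last by have [] := xP _ ilt.
  apply/LU; last exact: Uy.
  by apply: smB; [have [] := xP _ ilt|exact: sm_rhs].
have [i /Nx/LN//|j jn|y' Ny' Uy'] := sol (L \o x).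
  by rewrite -pp_lhs_linear; apply/LU; [exact: sm_lhs|exact: Ux].
have [y yP] := lift _ _ Ny'; exists y => [l /yP[]//|i ilt].
apply/LU; first by apply: smB; [exact: Nx|apply: sm_rhs => l /yP[]].
have -> : L (x i - pp_rhs s y i) =
    (L (x i) - pp_rhs s y' i) - pp_rhs s (fun l => (L \o y) l - y' l) i.
  by rewrite pp_rhsB linearB pp_rhs_linear opprB addrA subrK.
by apply: smB; [exact: Uy'|apply: sm_rhs => l /yP[]].
Qed.

Lemma solves_transfer Sg V W (L : {linear V -> W}) (N U : submod V) (N' U' : submod W) :
  (forall a, N a -> N' (L a)) ->
  (forall b, N' b -> exists2 a, N a & U' (L a - b)) ->
  (forall a, N a -> U a <-> U' (L a)) ->
  solves Sg N U <-> solves Sg N' U'.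
Proof.
by move=> LN Ls LU; split=> sol s /sol; have [] := @solv_transfer _ _ L N U N' U' s LN Ls LU.
Qed.

Lemma solves_onto Sg V W (L : {linear V -> W}) (N U : submod V) :
  (forall b, exists2 a, N a & L a = b) -> (forall a, N a -> U a <-> L a = 0) ->
  solves Sg N U <-> definable Sg W.
Proof.
move=> Ls LU; apply: (@solves_transfer _ _ _ L) => // b _.
by have [a Na <-] := Ls b; exists a => //=; rewrite subrr.
Qed.

Lemma definable_lquot Sg V (U : submod V) :
  solves Sg (sm_full V) U <-> definable Sg (lquot U).
Proof.
apply: (@solves_onto _ _ _ (@lquot_pi R V U)) => [b|a _].
  by have [a <-] := lquot_surj b; exists a.
by rewrite lquot_pi_eq0.
Qed.

Lemma solves_chain Sg V (T : Type) (le : T -> T -> Prop) (A : set T) (t0 : T)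
    (N U : T -> V -> Prop) :
  (forall r t, A r -> A t -> le r t \/ le t r) -> A t0 ->
  (forall r t x, le r t -> N r x -> N t x) ->
  (forall r t x, le r t -> U r x -> U t x) ->
  (forall t, A t -> solves Sg (N t) (U t)) ->
  solves Sg (fun x => exists2 t, A t & N t x) (fun x => exists2 t, A t & U t x).
Proof.
move=> Atot At0 Nmono Umono sol s Ss x Nx Ux.
(* Memberships of the entries and equations form one list of conditions, the equations being shifted
   by [pp_nx s]. *)
pose P n t := if (n < pp_nx s)%N then N t (x n) else U t (pp_lhs s x (n - pp_nx s)).
have [|n|t At Pt] := @chain_bound _ le A t0 P (pp_nx s + pp_nc s) Atot At0.
- by move=> i r t rt; rewrite /P; case: ifP => _; [exact: Nmono|exact: Umono].
- move=> nlt; rewrite /P; case: (ltnP n (pp_nx s)) => [nx|xn]; first exact: Nx.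
  by apply: Ux; rewrite ltn_subLR.
have [i ilt|j jlt|y Ny Uy] := sol t At s Ss x.
- by have := Pt i (ltn_addr _ ilt); rewrite /P ilt.
- have := Pt (pp_nx s + j)%N; rewrite ltn_add2l /P => /(_ jlt).
  by rewrite addKn ltnNge leq_addr.
by exists y => [l /Ny|i /Uy]; exists t.
Qed.

End Definable.

(* The closure of the tuple of values of hext under the module operations and
   under chosen solutions hsol of finite linear systems. *)
Inductive hull (R : pzRingType) (E L : Type) : Type :=
| hzero
| hadd of hull R E L & hull R E L
| hscale of R & hull R E L
| hsol of ppsys R & (nat -> hull R E L) & nat
| hext of E & (L -> hull R E L).
Arguments hzero {R E L}.

HB.instance Definition _ R E L := gen_eqMixin (hull R E L).
HB.instance Definition _ R E L := gen_choiceMixin (hull R E L).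

Section Hull.
Variables (R : pzRingType) (E L : Type) (C : lmodType R).
Variables (sol : ppsys R -> (nat -> C) -> nat -> C) (ext : E -> (L -> C) -> C).

(** Terms depend on [R], [E] and [L] but not on [C]: a module exhausted by evaluation is a quotient
    of a free module fixed beforehand. *)
Fixpoint hull_ev (t : hull R E L) : C :=
  match t with
  | hzero => 0
  | hadd t u => hull_ev t + hull_ev u
  | hscale r t => r *: hull_ev t
  | hsol s x i => sol s (fun j => hull_ev (x j)) i
  | hext e x => ext e (fun l => hull_ev (x l))
  end.

Lemma hull_im_lin a (x y : C) :
  range hull_ev x -> range hull_ev y -> range hull_ev (a *: x + y).
Proof. by move=> [t _ <-] [u _ <-]; exists (hadd (hscale a t) u). Qed.

Lemma hull_im0 : range hull_ev 0.
Proof. by exists hzero. Qed.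

Definition hull_im : submod C := Submod hull_im0 hull_im_lin.

Lemma hull_im_sol s (x : nat -> C) i :
  (forall j, hull_im (x j)) -> hull_im (sol s x i).
Proof.
move=> imx; have /choice[t tE] : forall j, exists t, hull_ev t = x j.
  by move=> j; have [t _ <-] := imx j; exists t.
by exists (hsol s t i) => //=; congr sol; apply/funext.
Qed.

Lemma hull_im_ext e (x : L -> C) : (forall l, hull_im (x l)) -> hull_im (ext e x).
Proof.
move=> imx; have /choice[t tE] : forall j, exists t, hull_ev t = x j.
  by move=> j; have [t _ <-] := imx j; exists t.
by exists (hext e t) => //=; congr ext; apply/funext.
Qed.

Lemma hull_lift_im (v : freemod R (hull R E L)) : hull_im (fm_lift hull_ev v).
Proof.
suff : sm_preim (fm_lift hull_ev) hull_im v by [].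
by apply: fm_span => t _ /=; rewrite fm_lift_delta; exists t.
Qed.

End Hull.

(** * Preenvelopes *)

(** The quotient of [I -> V] by [W] embodies the product of the [V / U i], where solutions are
    chosen in each coordinate separately. *)
Lemma solves_prod (R : pzRingType) (Sg : set (ppsys R)) (I : Type) (V : lmodType R)
    (U : I -> submod V) (W : submod (I -> V)) :
  (forall f, W f <-> forall i, U i (f i)) ->
  (forall i, solves Sg (sm_full V) (U i)) -> solves Sg (sm_full (I -> V)) W.
Proof.
move=> WU sol s Ss x _ Wx.
have lhsE j i : pp_lhs s x j i = pp_lhs s (x^~ i) j by rewrite /pp_lhs fct_sumE.
have /choice[y yP] : forall i, exists y : nat -> V,
    forall k, (k < pp_nx s)%N -> U i (x k i - pp_rhs s y k).
  move=> i; have [//|j jn|y _ yP] := sol i s Ss (x^~ i); last by exists y.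
  by rewrite -lhsE; apply: (WU _).1 => //; exact: Wx.
exists (fun l i => y i l) => // k kn; apply/WU => i.
have -> : (x k - pp_rhs s (fun l i => y i l) k) i = x k i - pp_rhs s (y i) k.
  rewrite /pp_rhs.
  rewrite [LHS](_ : _ = x k i - (\sum_(l < pp_ny s) pp_s s k l *: (y^~ l : I -> V)) i) //.
  by rewrite fct_sumE.
exact: yP.
Qed.

Section Preenvelope.
Variables (R : pzRingType) (Sg : set (ppsys R)).

Definition solve_rhs (X : lmodType R) (s : ppsys R) (x : nat -> X) : nat -> X :=
  xget (fun=> 0) [set y | forall i, (i < pp_nx s)%N -> x i = pp_rhs s y i].

Lemma hull_solves (E L : Type) (X : lmodType R) (ext : E -> (L -> X) -> X) :
  definable Sg X -> solves Sg (hull_im (@solve_rhs X) ext) (sm_zero X).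
Proof.
(* Only the first [pp_nx s] entries of [x] are known to lie in the hull; padding with zero makes the
   whole sequence admissible in [hull_im_sol]. *)
move=> defX s Ss x imx x0; pose x' i := if (i < pp_nx s)%N then x i else 0.
have x'E i : (i < pp_nx s)%N -> x' i = x i by rewrite /x' => ->.
have [//|//|y _ yP] := defX s Ss x.
have sP i : (i < pp_nx s)%N -> x' i = pp_rhs s (solve_rhs s x') i.
  rewrite /solve_rhs; case: xgetP => [y' _|/(_ y)[]]; first exact.
  by move=> j jn; apply/eqP; rewrite x'E // -subr_eq0 (yP j jn).
exists (solve_rhs s x') => [l _|i ilt]; last by rewrite /= -x'E // -sP // subrr.
apply: hull_im_sol => j; rewrite /x'; case: ifP => [/imx//|_]; exact: sm0.
Qed.

Variable M : lmodType R.

Let T := hull R M void.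
Let var (m : M) : freemod R T := fm_delta R (hext m (of_void T)).

(** An index is a quotient of one fixed free module, so the indices form a type over which a product
    can be taken; [env_lin] makes [var] linear modulo the index. *)
Record env_index := EnvIndex {
  env_sub :> submod (freemod R T);
  env_solves : solves Sg (sm_full _) env_sub;
  env_lin : forall a m m', env_sub (var (a *: m + m') - (a *: var m + var m')) }.

Lemma env_prod_lin a (f g : env_index -> freemod R T) :
  (forall i : env_index, i (f i)) -> (forall i : env_index, i (g i)) ->
  forall i : env_index, i ((a *: f + g) i).
Proof. by move=> Uf Ug i; apply: (sm_lin i). Qed.

Lemma env_prod0 (i : env_index) : i ((0 : env_index -> freemod R T) i).
Proof. exact: sm0. Qed.

Definition env_prod : submod (env_index -> freemod R T) := Submod env_prod0 env_prod_lin.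

Lemma definable_preenvelope :
  exists (E : lmodType R) (phi : {linear M -> E}), is_preenvelope (@definable R Sg) phi.
Proof.
have [|phi phiE] := @linear_ex R M (lquot env_prod) (fun m => lquot_pi env_prod (fun=> var m)).
  move=> a x y; rewrite -linearP; apply/lquot_pi_eq => i; exact: env_lin.
exists (lquot env_prod), phi; split.
  apply: (definable_lquot Sg env_prod).1; apply: (@solves_prod R Sg _ _ env_sub env_prod) => // i.
  exact: env_solves.
move=> X psi defX; pose ext m (_ : void -> X) := psi m.
pose L : {linear freemod R T -> X} := fm_lift (hull_ev (@solve_rhs X) ext).
have Lvar m : L (var m) = psi m by rewrite /L /= fm_lift_delta.
(* The quotient by the kernel of [L] is the hull of the image of [psi]. It is one of the indices,
   and [psi] factors through that coordinate of the product. *)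
have solL : solves Sg (sm_full _) (sm_ker L).
  have [|||_] := @solves_transfer _ Sg _ _ L (sm_full _) (sm_ker L)
      (hull_im (@solve_rhs X) ext) (sm_zero X);
    last by apply; exact: (@hull_solves _ _ X ext defX).
  - by move=> v _; exact: hull_lift_im.
  - move=> _ [t _ <-]; exists (fm_delta R t) => //.
    by rewrite /L /= fm_lift_delta subrr.
  - by [].
have linL a m m' : sm_ker L (var (a *: m + m') - (a *: var m + var m')).
  by rewrite /= linearB linearP !Lvar linearP subrr.
pose i := EnvIndex solL linL.
have [|G GE] := @linear_ex R (env_index -> freemod R T) X (fun f => L (f i)).
  by move=> a f g; rewrite -linearP.
have [//|f Uf|h hE] := @linear_factor _ _ _ _ (lquot_pi env_prod) (sm_zero _) G.
- by move=> b; have [a <-] := lquot_surj b; exists a; rewrite /= subrr.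
- by rewrite GE; apply: (lquot_pi_eq0 _ _).1 Uf i.
exists h => m; rewrite (hE (fun=> var m)); first by rewrite GE Lvar.
by rewrite phiE /= subrr.
Qed.

End Preenvelope.

(** * Small quotients *)

Definition solve_lhs (R : pzRingType) (C : lmodType R) (U : submod C) (s : ppsys R)
    (t : nat -> C) : nat -> C :=
  xget (fun=> 0) [set z | forall j, (j < pp_nc s)%N -> U (pp_lhs s z j - t j)].

(** Chosen solutions modulo [U] were put into the hull for this purpose: its image in [C / U] is
    pure. For [U = 0] the hull itself is pure in [C]. *)
Lemma hull_pure (R : pzRingType) (C : lmodType R) (U : submod C) (E L : Type)
    (ext : E -> (L -> C) -> C) (s : ppsys R) (z t : nat -> C) :
  let H := hull_im (@solve_lhs R C U) ext in
  (forall j, (j < pp_nc s)%N -> H (t j)) ->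
  (forall j, (j < pp_nc s)%N -> U (pp_lhs s z j - t j)) ->
  exists2 u, forall i, H (u i) & forall j, (j < pp_nc s)%N -> U (pp_lhs s u j - t j).
Proof.
move=> H Ht Uz; pose t' j := if (j < pp_nc s)%N then t j else 0.
have t'E j : (j < pp_nc s)%N -> t' j = t j by rewrite /t' => ->.
exists (solve_lhs U s t') => [i|j jn].
  by apply: hull_im_sol => j; rewrite /t'; case: ifP => [/Ht//|_]; exact: sm0.
rewrite -t'E // /solve_lhs; case: xgetP => [u _|/(_ z)[]]; first exact.
by move=> k kn /=; rewrite t'E //; exact: Uz.
Qed.

Section SmallQuotients.
Variables (R : pzRingType) (Sg : set (ppsys R)) (M : lmodType R).

(* Terms naming the elements of the closure of a single element *)
Let Tm := hull R unit void.

(* The type, over M, of a tuple a indexed by Tm: its linear relations, its image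
   in M and the positions of its prescribed entries; pat_at selects an entry. *)
Record pattern := Pattern {
  pat_rel : set (freemod R Tm);
  pat_im : Tm -> M;
  pat_fix : set Tm;
  pat_at : Tm }.

Definition pattern_hull := hull R pattern Tm.

Section Surjectivity.
Variables (C : lmodType R) (phi : {linear C -> M}).

Definition realizes (p : pattern) (a0 a : Tm -> C) :=
  [/\ forall v, pat_rel p v -> fm_lift a v = 0,
      forall t, phi (a t) = pat_im p t
    & forall t, pat_fix p t -> a t = a0 t].

(** The realizing tuple is selected without looking at [pat_at], so patterns that differ only there
    return entries of one and the same tuple. *)
Definition realize (p : pattern) (a0 : Tm -> C) : C :=
  xget (fun=> 0) [set a | realizes p a0 a] (pat_at p).

Definition pattern_ev : pattern_hull -> C := hull_ev (solve_lhs (sm_zero C)) realize.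
Let D : submod C := hull_im (solve_lhs (sm_zero C)) realize.

(** This is the saturation of [D]: the type of any tuple indexed by [Tm], with its entries in [D]
    kept fixed, is realized inside [D]. *)
Lemma pattern_realize (a : Tm -> C) : exists a' : Tm -> C,
  [/\ forall t, D (a' t), forall v, fm_lift a v = 0 -> fm_lift a' v = 0,
      forall t, phi (a' t) = phi (a t) & forall t, D (a t) -> a' t = a t].
Proof.
(* Entries outside [D] are replaced by zero, so that all arguments of [realize] lie in [D]; the
   pattern prescribes only the other entries. *)
pose a0 t := if `[< D (a t) >] then a t else 0.
pose p := Pattern [set v | fm_lift a v = 0] (phi \o a) [set t | D (a t)].
exists (fun t => realize (p t) a0).
have ra : realizes (p hzero) a0 a.
  by split=> // t; rewrite /= /a0; case: asboolP.
have [r1 r2 r3] : realizes (p hzero) a0 (fun t => realize (p t) a0).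
  rewrite /realize /=; exact: (@xgetPex _ _ [set a' | realizes (p hzero) a0 a'] (ex_intro _ a ra)).
split=> // [t|t Da].
  by apply: hull_im_ext => l; rewrite /a0; case: asboolP => // _; exact: sm0.
by rewrite r3 // /a0; case: asboolP.
Qed.

(* If x is not in D, take a submodule T containing x with D + T pure in C.  The
   saturation of D gives a retraction r : D + T -> D over M, and its kernel is a
   nonzero pure submodule of C on which phi vanishes. *)
Lemma pattern_ev_surj :
  definable Sg C ->
  (forall P : submod C, (forall x, P x -> phi x = 0) -> solves Sg (sm_full C) P ->
    forall x, P x -> x = 0) ->
  forall x, exists t, pattern_ev t = x.
Proof.
move=> defC Cmin x; suff [t _ tx] : D x by exists t.
apply: contrapT => nDx.
pose ext (_ : unit) (_ : void -> C) := x.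
pose a : Tm -> C := hull_ev (solve_lhs D) ext.
pose T : submod C := hull_im (solve_lhs D) ext.
have [a' [Da' rel' im' fix']] := pattern_realize a.
pose L : {linear freemod R Tm -> C} := fm_lift a.
pose L' : {linear freemod R Tm -> C} := fm_lift a'.
have Ld t : L (fm_delta R t) = a t by rewrite /L /= fm_lift_delta.
have L'd t : L' (fm_delta R t) = a' t by rewrite /L' /= fm_lift_delta.
have DL' v : D (L' v).
  suff : sm_preim L' D v by [].
  by apply: fm_span => t _ /=; rewrite fm_lift_delta; exact: Da'.
have phiL v : phi (L' v) = phi (L v).
  have := @fm_ext R Tm M (phi \o L') (phi \o L) _ v; apply=> t.
  by rewrite /= !fm_lift_delta.
(* [T] is exactly the set of values of [a], so an element of [D] of the form [L v] is an entry of
   the tuple, which [a'] keeps fixed; thus the retraction is well defined. *)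
have LD v : D (L v) -> L' v = L v.
  move=> DLv; have [t _ tE] : T (L v) by exact: hull_lift_im.
  have /rel' : L (v - fm_delta R t) = 0 by rewrite linearB Ld -tE subrr.
  move/eqP; rewrite -[fm_lift a']/(L' : _ -> _) linearB L'd subr_eq0 => /eqP ->.
  by rewrite -tE; apply: fix'; rewrite /a tE.
have Plin c (y z : C) : (exists v, L v - L' v = y) -> (exists v, L v - L' v = z) ->
    exists v, L v - L' v = c *: y + z.
  move=> [v <-] [w <-]; exists (c *: v + w).
  by rewrite (linearP L) (linearP L') scalerBr opprD addrACA.
have P0 : exists v, L v - L' v = 0 by exists 0; rewrite (linear0 L) (linear0 L') subr0.
(* The kernel of the retraction [d + L v |-> d + L' v] of [D + T] onto [D]. *)
pose P := Submod P0 Plin.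
have xa : a (hext tt (of_void _)) = x by [].
apply: nDx; rewrite -xa.
suff -> : a (hext tt (of_void _)) = a' (hext tt (of_void _)) by exact: Da'.
apply/eqP; rewrite -subr_eq0; apply/eqP; apply: (Cmin P).
- by move=> _ [v <-]; rewrite linearB phiL subrr.
- move=> s Ss z _ Pz.
  have /choice[v vE] : forall j, exists v, (j < pp_nc s)%N -> L v - L' v = pp_lhs s z j.
    move=> j; case: (ltnP j (pp_nc s)) => [/Pz[v vE]|_]; last by exists 0.
    by exists v.
  have [||w Tw Dw] := @hull_pure R C D _ _ ext s z (L \o v).
  + by move=> j _; exact: hull_lift_im.
  + move=> j jn; have -> : pp_lhs s z j - (L \o v) j = - L' (v j); last exact/smN/DL'.
    by rewrite -vE //= addrAC subrr sub0r.
  have /choice[om omE] : forall i, exists v, L v = w i.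
    by move=> i; have [t _ <-] := Tw i; exists (fm_delta R t); rewrite Ld.
  have Lom j : L (pp_lhs s om j) = pp_lhs s w j.
    by rewrite pp_lhs_linear; congr (pp_lhs s _ j); apply/funext => i; exact: omE.
  (* Correct [z] by elements of [P]. Modulo [D], [L] takes the same value at [pp_lhs s om j] and at
     [v j], so [L] and [L'] agree at their difference and [z'] solves the homogeneous system exactly
     in [C]. *)
  pose z' i := z i - (L (om i) - L' (om i)).
  have z'0 j : (j < pp_nc s)%N -> pp_lhs s z' j = 0.
    move=> jn; have /LD : D (L (pp_lhs s om j - v j)).
      by rewrite linearB Lom; exact: Dw.
    rewrite (linearB L) (linearB L') => e.
    rewrite pp_lhsB -vE // pp_lhsB -[pp_lhs s _ j](pp_lhs_linear L).
    rewrite -[X in _ - (_ - X)](pp_lhs_linear L').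
    by rewrite opprB addrACA [L _ + L' _]addrC addrACA e -[L (v j) - _]opprB subrr.
  have [//|//|y _ yP] := defC s Ss z'; exists y => // i ilt.
  exists (om i); have := yP i ilt; rewrite /= => /eqP; rewrite subr_eq0 => /eqP <-.
  by rewrite /z' opprB [RHS]addrC subrK.
- by exists (fm_delta R (hext tt (of_void _))); rewrite Ld L'd.
Qed.

End Surjectivity.
End SmallQuotients.

(** * Precovers *)

Section MaximalKernel.
Variables (R : pzRingType) (Sg : set (ppsys R)) (M C : lmodType R) (psi : {linear C -> M}).

Record kernel_quot := KernelQuot {
  kq_sub :> submod C;
  kq_ker : forall x, kq_sub x -> psi x = 0;
  kq_solves : solves Sg (sm_full C) kq_sub }.

Let le (P Q : kernel_quot) := forall x, P x -> Q x.

Lemma kernel_quot_chain (A : set kernel_quot) P0 : A P0 ->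
  (forall P Q, A P -> A Q -> le P Q \/ le Q P) ->
  exists Q : kernel_quot, forall P, A P -> le P Q.
Proof.
move=> AP0 Atot.
have [//|U UE] := @chain_submod _ _ _ le A P0 kq_sub Atot AP0; first by move=> P Q x; exact.
have Uker x : U x -> psi x = 0 by move=> /UE[P _ /kq_ker].
have Usol : solves Sg (sm_full C) U.
  move=> s Ss x _ Ux.
  have [//|P Q z PQ|i _|j jn|y _ yP] := @solves_chain _ Sg _ _ le A P0 (fun=> sm_full C) kq_sub
    Atot AP0 _ _ (fun P _ => @kq_solves P) s Ss x.
  - exact: PQ.
  - by exists P0.
  - exact/UE/Ux.
  by exists y => // i /yP/UE.
by exists (KernelQuot Uker Usol) => P AP x Px; apply/UE; exists P.
Qed.

Lemma kernel_quot_max : definable Sg C -> exists P : kernel_quot,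
  forall Q : kernel_quot, (forall x, P x -> Q x) -> forall x, Q x -> P x.
Proof.
move=> defC.
have ker0 x : sm_zero C x -> psi x = 0 by move=> ->; exact: linear0.
have [||A Atot|P maxP] := @ZL_preorder _ (KernelQuot ker0 defC) (fun P Q => `[< le P Q >]).
- by move=> P; apply/asboolP.
- by move=> P Q S /asboolP PQ /asboolP QS; apply/asboolP => x /PQ/QS.
- have [[P0 AP0]|nA] := pselect (exists P, A P); last first.
    by exists (KernelQuot ker0 defC) => P AP; case: nA; exists P.
  have [|Q QP] := kernel_quot_chain AP0; last by exists Q => P AP; apply/asboolP/QP.
  by move=> P Q AP AQ; have [/asboolP|/asboolP] := Atot P Q AP AQ; [left|right].
by exists P => Q PQ; apply/asboolP/maxP/asboolP.
Qed.

End MaximalKernel.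

(** A maximal kernel leaves a quotient [Q] with no proper quotient over [M] in the class, as
    [pattern_ev_surj] requires; the terms of [pattern_hull M] then exhaust [Q], whatever the size of
    [C]. *)
Lemma small_quotient (R : pzRingType) (Sg : set (ppsys R)) (M C : lmodType R)
    (psi : {linear C -> M}) : definable Sg C ->
  exists (Q : lmodType R) (p : {linear C -> Q}) (psi' : {linear Q -> M})
      (ev : pattern_hull M -> Q),
    [/\ definable Sg Q, forall x, psi' (p x) = psi x & forall q, exists t, ev t = q].
Proof.
move=> defC; have [P maxP] := kernel_quot_max psi defC.
have defQ : definable Sg (lquot P) by apply: (definable_lquot Sg P).1; exact: kq_solves.
have [||psi' psi'E] := @linear_factor _ _ _ _ (lquot_pi P) (sm_zero _) psi.
- by move=> q; have [x <-] := lquot_surj q; exists x; rewrite /= subrr.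
- by move=> x /lquot_pi_eq0; exact: kq_ker.
have psi'pi x : psi' (lquot_pi P x) = psi x by apply: psi'E; rewrite /= subrr.
exists (lquot P), (lquot_pi P), psi', (pattern_ev psi'); split=> //.
apply: (pattern_ev_surj defQ) => K Kker Ksol q.
have preK_ker x : sm_preim (lquot_pi P) K x -> psi x = 0 by rewrite -psi'pi; exact: Kker.
have preK_sol : solves Sg (sm_full C) (sm_preim (lquot_pi P) K).
  apply: (@solves_transfer _ Sg _ _ (lquot_pi P) (sm_full _) _ (sm_full _) K _ _ _).2 => //.
  by move=> b _; have [x <-] := lquot_surj b; exists x => //; rewrite subrr; exact: sm0.
have [x <-] := lquot_surj q => Kx; apply/lquot_pi_eq0.
apply: (maxP (KernelQuot preK_ker preK_sol)) => //= y Py.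
by rewrite (_ : lquot_pi P y = 0); [exact: sm0|exact/lquot_pi_eq0].
Qed.

Section Precover.
Variables (R : pzRingType) (Sg : set (ppsys R)) (M : lmodType R).

Let W := pattern_hull M.

(** Up to isomorphism, the modules over [M] in the class whose elements are generated by a family
    indexed by [W]; [cov_ker] lets [cov_map] descend to the quotient. *)
Record cov_index := CovIndex {
  cov_sub :> submod (freemod R W);
  cov_map : W -> M;
  cov_solves : solves Sg (sm_full _) cov_sub;
  cov_ker : forall v, cov_sub v -> fm_lift cov_map v = 0 }.

HB.instance Definition _ := gen_eqMixin cov_index.
HB.instance Definition _ := gen_choiceMixin cov_index.

Let Z := (cov_index * W)%type.

Definition cov_in (i : cov_index) : {linear freemod R W -> freemod R Z} :=
  fm_lift (fun w => fm_delta R (i, w)).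

Definition cov_out (i : cov_index) : {linear freemod R Z -> freemod R W} :=
  fm_lift (fun z => if z.1 == i then fm_delta R z.2 else 0).

Lemma cov_in_delta i w : cov_in i (fm_delta R w) = fm_delta R (i, w).
Proof. by rewrite /cov_in /= fm_lift_delta. Qed.

Lemma cov_out_delta i z : cov_out i (fm_delta R z) = if z.1 == i then fm_delta R z.2 else 0.
Proof. by rewrite /cov_out /= fm_lift_delta. Qed.

Lemma cov_inK i v : cov_out i (cov_in i v) = v.
Proof.
apply: (@fm_ext R W _ (cov_out i \o cov_in i) idfun) => w.
by rewrite [LHS]/= cov_in_delta cov_out_delta eqxx.
Qed.

Lemma cov_in_neq i j v : i != j -> cov_out j (cov_in i v) = 0.
Proof.
move=> /negPf ij; suff : sm_ker (cov_out j \o cov_in i) v by [].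
apply: fm_span => w _; change (cov_out j (cov_in i (fm_delta R w)) = 0).
by rewrite cov_in_delta cov_out_delta ij.
Qed.

Lemma cov_fin (x : freemod R Z) : exists J : seq cov_index,
  [/\ uniq J, forall i, i \notin J -> cov_out i x = 0
    & x = \sum_(i <- J) cov_in i (cov_out i x)].
Proof.
have [A [sA xE]] := fm_expand x; exists (undup [seq z.1 | z <- A]).
set J := undup _.
have inJ z : fm_val x z != 0 -> z.1 \in J.
  by rewrite -sA => zA; rewrite mem_undup; apply: map_f.
split=> [|i iJ|]; first exact: undup_uniq.
  suff : sm_ker (cov_out i) x by [].
  apply: fm_span => z /inJ zJ; change (cov_out i (fm_delta R z) = 0).
  by rewrite cov_out_delta; case: eqP => // zi; rewrite zi (negPf iJ) in zJ.
have [|f fE] := @linear_ex R _ _ (fun x => \sum_(i <- J) cov_in i (cov_out i x)).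
  move=> a y z; rewrite scaler_sumr -big_split /=; apply: eq_bigr => i _.
  by rewrite !linearP.
rewrite -fE; apply: (@fm_supp_eq R Z _ idfun f) => -[i w] /inJ iJ /=.
rewrite fE (bigD1_seq i) ?undup_uniq //= big1 ?addr0 => [|j ji]; last first.
  by rewrite cov_out_delta eq_sym (negPf ji) linear0.
by rewrite cov_out_delta eqxx cov_in_delta.
Qed.

Lemma cov_sum_lin a (x y : freemod R Z) :
  (forall i : cov_index, i (cov_out i x)) -> (forall i : cov_index, i (cov_out i y)) ->
  forall i : cov_index, i (cov_out i (a *: x + y)).
Proof. by move=> Ux Uy i; rewrite linearP; apply: (sm_lin i). Qed.

Lemma cov_sum0 (i : cov_index) : i (cov_out i 0).
Proof. by rewrite linear0; exact: sm0. Qed.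

(* The quotient of the free module on Z by cov_sum is the direct sum over i of
   the quotients of the free module on W by cov_sub i. *)
Definition cov_sum : submod (freemod R Z) := Submod cov_sum0 cov_sum_lin.

Lemma cov_sum_solves : solves Sg (sm_full _) cov_sum.
Proof.
move=> s Ss x _ Ux.
have /choice[J JP] : forall k, exists J : seq cov_index,
    forall i, i \notin J -> cov_out i (x k) = 0.
  by move=> k; have [J [_ JP _]] := cov_fin (x k); exists J.
(* Only the finitely many indices in [K] meet the given tuple. Elsewhere the zero solution serves,
   so the coordinatewise solutions add up to an element of the direct sum. *)
pose K := undup (flatten [seq J k | k <- iota 0 (pp_nx s)]).
have KP i k : (k < pp_nx s)%N -> i \notin K -> cov_out i (x k) = 0.
  move=> kn iK; apply: JP; apply: contra iK => iJ; rewrite mem_undup.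
  by apply/flatten_mapP; exists k => //; rewrite mem_iota.
have /choice[y yP] : forall i : cov_index, exists y : nat -> freemod R W,
    forall k, (k < pp_nx s)%N -> i (cov_out i (x k) - pp_rhs s y k).
  move=> i; have [//|j jn|y _ yP] := @cov_solves i s Ss (cov_out i \o x); last by exists y.
  by rewrite -pp_lhs_linear; exact: Ux.
pose y' l := \sum_(i <- K) cov_in i (y i l).
have outy' i l : cov_out i (y' l) = if i \in K then y i l else 0.
  rewrite linear_sum /=; case: ifPn => iK.
    rewrite (bigD1_seq i) ?undup_uniq //= cov_inK big1 ?addr0 // => j ji.
    exact: cov_in_neq.
  rewrite big1_seq // => j /= jK; apply: cov_in_neq; apply: contraNneq iK => <-.
  by [].
exists y' => // k kn i; rewrite linearB pp_rhs_linear.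
have [iK|iK] := boolP (i \in K).
  have -> : cov_out i \o y' = y i by apply/funext => l /=; rewrite outy' iK.
  exact: yP.
have -> : cov_out i \o y' = fun=> 0.
  by apply/funext => l /=; rewrite outy' (negPf iK).
rewrite KP // sub0r /pp_rhs big1 ?oppr0; first exact: sm0.
by move=> l _; rewrite scaler0.
Qed.

Let pi : {linear freemod R Z -> M} := fm_lift (fun z : Z => cov_map z.1 z.2).

Lemma pi_in i v : pi (cov_in i v) = fm_lift (@cov_map i) v.
Proof.
apply: (@fm_ext R W _ (pi \o cov_in i) (fm_lift (@cov_map i))) => w.
by rewrite [LHS]/= cov_in_delta /pi /= !fm_lift_delta.
Qed.

Lemma cov_sum_ker x : cov_sum x -> pi x = 0.
Proof.
move=> Ux; have [J [_ _ ->]] := cov_fin x; rewrite linear_sum big1 // => i _.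
by rewrite pi_in cov_ker.
Qed.

Lemma definable_precover :
  exists (C : lmodType R) (phi : {linear C -> M}), is_precover (@definable R Sg) phi.
Proof.
have [||phi phiE] := @linear_factor _ _ _ _ (lquot_pi cov_sum) (sm_zero _) pi.
- by move=> q; have [x <-] := lquot_surj q; exists x; rewrite /= subrr.
- by move=> x /lquot_pi_eq0; exact: cov_sum_ker.
exists (lquot cov_sum), phi; split.
  exact: (definable_lquot Sg cov_sum).1 cov_sum_solves.
move=> C psi /(small_quotient psi)[Q [p [psi' [ev [defQ psi'E evsurj]]]]].
pose L : {linear freemod R W -> Q} := fm_lift ev.
have Ld w : L (fm_delta R w) = ev w by rewrite /L /= fm_lift_delta.
have solL : solves Sg (sm_full _) (sm_ker L).
  apply: (@solves_onto _ Sg _ _ L (sm_full _) (sm_ker L) _ _).2 => // q.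
  by have [w <-] := evsurj q; exists (fm_delta R w).
have kerL v : sm_ker L v -> fm_lift (psi' \o ev) v = 0.
  by move=> Lv; rewrite fm_lift_comp [fm_lift ev v]Lv linear0.
pose i := CovIndex solL kerL.
have [||h hE] := @linear_factor _ _ _ _ L (sm_zero _) (lquot_pi cov_sum \o cov_in i).
- by move=> q; have [w <-] := evsurj q; exists (fm_delta R w); rewrite /= Ld subrr.
- move=> v Lv; apply/lquot_pi_eq0 => j; have [<-|ij] := eqVneq i j.
    by rewrite cov_inK.
  by rewrite cov_in_neq //; exact: sm0.
exists (h \o p) => x; have [w wE] := evsurj (p x); rewrite /= -wE.
rewrite (hE (fm_delta R w)); last by rewrite /= Ld subrr.
rewrite (phiE (cov_in i (fm_delta R w))); last by rewrite /= subrr.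
by rewrite pi_in fm_lift_delta /= wE psi'E.
Qed.

End Precover.

(** * Presentations over a module *)

Section Support.
Variables (R : pzRingType) (Z : choiceType) (Y : set Z).

Definition supported (x : freemod R Z) := forall z, fm_val x z != 0 -> Y z.

Lemma supported0 : supported 0.
Proof. by move=> z; rewrite eqxx. Qed.

Lemma supported_lin a x y : supported x -> supported y -> supported (a *: x + y).
Proof.
move=> sx sy z; have [x0|/sx//] := eqVneq (fm_val x z) 0.
have [y0|/sy//] := eqVneq (fm_val y z) 0.
by rewrite [X in X != 0](_ : _ = a *: fm_val x z + fm_val y z) // x0 y0 scaler0 addr0 eqxx.
Qed.

Definition sm_supp : submod (freemod R Z) := Submod supported0 supported_lin.

Lemma supp_delta z : Y z -> sm_supp (fm_delta R z).
Proof. by move=> Yz t /=; have [->|_] := eqVneq t z; rewrite ?eqxx. Qed.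

Definition supp_proj : {linear freemod R Z -> freemod R Z} :=
  fm_lift (fun z => if `[< Y z >] then fm_delta R z else 0).

Lemma supp_projP x : sm_supp (supp_proj x).
Proof.
suff : sm_preim supp_proj sm_supp x by [].
apply: fm_span => z _; rewrite /= fm_lift_delta; case: asboolP => [|_]; first exact: supp_delta.
exact: (sm0 sm_supp).
Qed.

Lemma supp_proj_id x : sm_supp x -> supp_proj x = x.
Proof.
move=> sx; apply: (@fm_supp_eq R Z _ supp_proj idfun) => z /sx Yz.
by rewrite /= fm_lift_delta asboolT.
Qed.

End Support.

Section Stages.
Variables (R : pzRingType) (Sg : set (ppsys R)) (M C : lmodType R) (phi : {linear C -> M}).
Variables (Z : choiceType) (k : Z -> C).

Let V := freemod R Z.
Let kappa : {linear V -> C} := fm_lift k.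

(* The module presented by the generators st_gen and the relations st_rel; it
   lives over M through phi \o kappa. *)
Record stage := Stage {
  st_gen : set Z;
  st_rel : submod V;
  st_supp : forall x, st_rel x -> sm_supp R st_gen x;
  st_ker : forall x, st_rel x -> phi (kappa x) = 0;
  st_solves : solves Sg (sm_supp R st_gen) st_rel }.

Definition stage_le s t :=
  st_gen s `<=` st_gen t /\ forall x, st_rel s x -> st_rel t x.

Lemma stage_union (A : set stage) s0 : A s0 ->
  (forall s t, A s -> A t -> stage_le s t \/ stage_le t s) ->
  exists t, [/\ forall s, A s -> stage_le s t,
    forall z, st_gen t z <-> exists2 s, A s & st_gen s z,
    forall x, st_rel t x <-> exists2 s, A s & st_rel s x &
    forall x, sm_supp R (st_gen t) x <-> exists2 s, A s & sm_supp R (st_gen s) x].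
Proof.
move=> As0 Atot; pose Y := [set z | exists2 s, A s & st_gen s z].
have suppm s t x : stage_le s t -> sm_supp R (st_gen s) x -> sm_supp R (st_gen t) x.
  by move=> [st _] sx z /sx/st.
have relm s t x : stage_le s t -> st_rel s x -> st_rel t x by move=> [_]; exact.
have [F FE] := @chain_submod _ _ _ stage_le A s0 (fun s => sm_supp R (st_gen s)) Atot As0 suppm.
have [U UE] := @chain_submod _ _ _ stage_le A s0 st_rel Atot As0 relm.
have YF x : sm_supp R Y x <-> F x.
  split=> [Yx|/FE[s As sx] z /sx sz]; last by exists s.
  by apply: fm_span => z /Yx[s As sz]; apply/FE; exists s => //; exact: supp_delta.
have Usupp x : U x -> sm_supp R Y x.
  by move=> /UE[s As /st_supp sx]; apply/YF/FE; exists s.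
have Uker x : U x -> phi (kappa x) = 0 by move=> /UE[s _ /st_ker].
have Usol : solves Sg (sm_supp R Y) U.
  move=> s Ss x Yx Ux.
  have [i /Yx/YF/FE//|j /Ux/UE//|y Ny Uy] := @solves_chain _ Sg _ _ stage_le A s0
    (fun s => sm_supp R (st_gen s)) st_rel Atot As0 suppm relm (fun t _ => @st_solves t) s Ss x.
  by exists y => [l /Ny/FE/YF|i /Uy/UE].
exists (Stage Usupp Uker Usol); split=> //= [s As|x].
  by split=> [z sz|x sx]; [exists s|apply/UE; exists s].
by split=> [/YF/FE|/FE/YF].
Qed.

Lemma stage_zorn (Q : stage -> Prop) s0 : Q s0 ->
  (forall (A : set stage) t, (forall s, A s -> Q s) -> (exists s, A s) ->
    (forall s t, A s -> A t -> stage_le s t \/ stage_le t s) ->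
    (forall z, st_gen t z <-> exists2 s, A s & st_gen s z) ->
    (forall x, st_rel t x <-> exists2 s, A s & st_rel s x) ->
    (forall x, sm_supp R (st_gen t) x <-> exists2 s, A s & sm_supp R (st_gen s) x) -> Q t) ->
  exists2 s, Q s & forall t, Q t -> stage_le s t -> stage_le t s.
Proof.
move=> Qs0 Qunion; pose T := {s | Q s}.
have [||A Atot|[s Qs] maxs] :=
  @ZL_preorder T (exist _ s0 Qs0) (fun s t => `[< stage_le (sval s) (sval t) >]).
- by move=> s; apply/asboolP; split.
- move=> r s t /asboolP[rs1 rs2] /asboolP[st1 st2]; apply/asboolP.
  by split=> [z /rs1/st1|x /rs2/st2].
- have [[[s As] sA]|nA] := pselect (exists s, A s); last first.
    by exists (exist _ s0 Qs0) => s As; case: nA; exists s.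
  pose B := [set s | exists Qs : Q s, A (exist _ s Qs)].
  have Btot r t : B r -> B t -> stage_le r t \/ stage_le t r.
    by move=> [Qr Ar] [Qt At]; have [/asboolP|/asboolP] := Atot _ _ Ar At; [left|right].
  have Bs : B s by exists As.
  have [t [tub tgen trel tsupp]] := stage_union Bs Btot.
  have Qt : Q t by apply: (Qunion B t) => // [r [Qr _] //|]; exists s.
  by exists (exist _ t Qt) => -[r Qr] Ar; apply/asboolP/tub; exists Qr.
exists s => // t Qt st; apply/asboolP.
by apply: (maxs (exist _ t Qt)); apply/asboolP.
Qed.

Lemma stage_empty :
  exists s, st_gen s = set0 /\ forall x, sm_supp R (st_gen s) x -> x = 0.
Proof.
have supp0 (x : V) : sm_supp R set0 x -> x = 0.
  move=> sx; rewrite -(supp_proj_id sx); apply: (@fm_supp_eq R Z _ (supp_proj R set0) \0) => z.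
  by move=> /sx.
have zsupp (x : V) : sm_zero V x -> sm_supp R set0 x by move=> ->; exact: sm0.
have zker (x : V) : sm_zero V x -> phi (kappa x) = 0 by move=> ->; rewrite !linear0.
have zsol : solves Sg (sm_supp R set0) (sm_zero V).
  move=> s Ss x x0 _; exists (fun=> 0) => [l _|i ilt]; first exact: sm0.
  by rewrite (supp0 _ (x0 i ilt)) /pp_rhs big1 ?subr0 // => l _; rewrite scaler0.
by exists (Stage zsupp zker zsol).
Qed.

(* A stage whose module maps to C by G is continued to a stage whose module is
   C, when the new generators in E cover the part of C missed by G. *)
Lemma stage_extend (s : stage) (G : {linear V -> C}) (E : set Z) :
  definable Sg C -> (forall z, E z -> ~ st_gen s z) ->
  (forall x, sm_supp R (st_gen s) x -> phi (G x) = phi (kappa x)) ->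
  (forall x, st_rel s x -> G x = 0) ->
  (forall c, (exists2 x, sm_supp R (st_gen s) x & G x = c) \/ (exists2 z, E z & k z = c)) ->
  exists (t : stage) (G' : {linear V -> C}),
    (forall c, exists2 x, sm_supp R (st_gen t) x & G' x = c) /\
    [/\ st_gen t = st_gen s `|` E,
        forall x, st_rel t x <-> sm_supp R (st_gen t) x /\ G' x = 0,
        forall x, sm_supp R (st_gen s) x -> G' x = G x,
        forall z, E z -> G' (fm_delta R z) = k z
      & forall x, sm_supp R (st_gen t) x -> phi (G' x) = phi (kappa x)].
Proof.
move=> defC Es Gphi G0 Gsurj; pose Y := st_gen s `|` E.
(* New generators go to their labels and old ones follow [G]; taking the whole kernel as relations
   identifies the new module with [C]. *)
pose G' : {linear V -> C} :=
  fm_lift (fun z => if `[< E z >] then k z else G (fm_delta R z)).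
have G'E z : E z -> G' (fm_delta R z) = k z by move=> Ez; rewrite /G' /= fm_lift_delta asboolT.
have G's x : sm_supp R (st_gen s) x -> G' x = G x.
  move=> sx; apply: fm_supp_eq => z /sx sz; rewrite /G' /= fm_lift_delta asboolF //.
  by move=> /Es.
have G'phi x : sm_supp R Y x -> phi (G' x) = phi (kappa x).
  move=> Yx; apply: (@fm_supp_eq R Z _ (phi \o G') (phi \o kappa)) => z /Yx[sz|Ez] /=.
    by rewrite G's ?Gphi //; exact: supp_delta.
  by rewrite -[fm_lift _ _]/(G' _) G'E // fm_lift_delta.
pose U := sm_cap (sm_supp R Y) (sm_ker G').
have Usupp x : U x -> sm_supp R Y x by case.
have Uker x : U x -> phi (kappa x) = 0 by move=> [Yx G'x]; rewrite -G'phi // G'x linear0.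
have G'surj c : exists2 x, sm_supp R Y x & G' x = c.
  have [[x sx <-]|[z Ez <-]] := Gsurj c.
    by exists x; [move=> z /sx; left|exact: G's].
  by exists (fm_delta R z); [apply: supp_delta; right|exact: G'E].
have Usol : solves Sg (sm_supp R Y) U.
  by apply: (@solves_onto _ Sg _ _ G' _ U _ _).2 => // x Yx; split=> [[]|].
by exists (Stage Usupp Uker Usol), G'.
Qed.

(** A quotient of the whole free module: composing with the projection kills the generators outside
    [st_gen s]. *)
Definition stage_mod (s : stage) : lmodType R :=
  lquot (sm_preim (supp_proj R (st_gen s)) (st_rel s)).

Definition stage_pi (s : stage) : {linear V -> stage_mod s} := @lquot_pi R V _.

Lemma stage_pi_eq0 s x : sm_supp R (st_gen s) x -> stage_pi s x = 0 <-> st_rel s x.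
Proof. by move=> sx; rewrite /stage_pi lquot_pi_eq0 /= supp_proj_id. Qed.

Lemma stage_surj s (q : stage_mod s) :
  exists2 x, sm_supp R (st_gen s) x & stage_pi s x = q.
Proof.
have [x <-] := lquot_surj q; exists (supp_proj R (st_gen s) x); first exact: supp_projP.
apply/lquot_pi_eq; rewrite /= linearB [X in X - _]supp_proj_id; last exact: supp_projP.
by rewrite subrr; exact: sm0.
Qed.

Lemma stage_definable s : definable Sg (stage_mod s).
Proof.
apply: (definable_lquot Sg _).1.
apply: (@solves_transfer _ Sg _ _ (supp_proj R (st_gen s)) _ _ (sm_supp R (st_gen s))
  (st_rel s) _ _ _).2.
- by move=> x _; exact: supp_projP.
- by move=> x sx; exists x => //; rewrite supp_proj_id // subrr; exact: sm0.
- by [].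
exact: st_solves.
Qed.

Lemma stage_over s : exists psi : {linear stage_mod s -> M},
  forall x, sm_supp R (st_gen s) x -> psi (stage_pi s x) = phi (kappa x).
Proof.
pose G : {linear V -> M} := phi \o (kappa \o supp_proj R (st_gen s)).
have [||psi psiE] := @linear_factor _ _ _ _ (stage_pi s) (sm_zero _) G.
- by move=> q; have [x _ <-] := stage_surj q; exists x; rewrite /= subrr.
- by move=> x /lquot_pi_eq0; exact: st_ker.
exists psi => x sx.
have -> : psi (stage_pi s x) = G x by apply: psiE; rewrite /= subrr.
by change (phi (kappa (supp_proj R (st_gen s) x)) = phi (kappa x)); rewrite supp_proj_id.
Qed.

End Stages.

(** * Covers *)

(* Generators labelled by the element of a free module whose vanishing justifies
   their introduction. *)
Inductive kill_gen (R : pzRingType) (C : Type) : Type :=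
  KillGen of seq (R * kill_gen R C) & C.

HB.instance Definition _ R C := gen_eqMixin (kill_gen R C).
HB.instance Definition _ R C := gen_choiceMixin (kill_gen R C).

Section InjectiveEndomorphisms.
Variables (R : pzRingType) (Sg : set (ppsys R)) (M C : lmodType R) (phi : {linear C -> M}).
Hypothesis phi_precover : is_precover (@definable R Sg) phi.

Let Z := kill_gen R C.
Let V := freemod R Z.
Let k (z : Z) : C := let: KillGen _ c := z in c.
Let base (c : C) : V := fm_delta R (KillGen [::] c).

Let comb (l : seq (R * Z)) : V := \sum_(p <- l) p.1 *: fm_delta R p.2.

Let comb_surj (x : V) : exists l, comb l = x.
Proof.
have [A [_ xE]] := fm_expand x; exists [seq (fm_val x z : R, z) | z <- A].
by rewrite /comb big_map /= -xE.
Qed.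

Let stage := stage Sg phi k.

(** By the first clause, a label whose combination is not yet a relation is fresh. The other two
    keep [base] a linear map from [C], through which the precover property is inherited. *)
Let kill_stage (s : stage) :=
  [/\ forall l c, st_gen s (KillGen l c) -> st_rel s (comb l),
      forall c, st_gen s (KillGen [::] c)
    & forall a c c', st_rel s (base (a *: c + c') - (a *: base c + base c'))].

Let kill_init : exists s, kill_stage s.
Proof.
have [s0 [gen0 supp0]] := stage_empty Sg phi k.
have [z _|x /supp0->|x /st_supp/supp0->|c|t [G [_ [tgen trel _ tE _]]]] :=
  @stage_extend _ Sg _ _ phi _ k s0 \0 [set z | exists c, z = KillGen [::] c] phi_precover.1.
- by rewrite gen0.
- by rewrite !linear0.
- by [].
- by right; exists (KillGen [::] c) => //; exists c.
have tbase c : st_gen t (KillGen [::] c) by rewrite tgen; right; exists c.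
have Gbase c : G (base c) = c by rewrite tE //; exists c.
exists t; split=> // [l c|a c c'].
  by rewrite tgen gen0 set0U => -[_ [-> _]]; rewrite /comb big_nil; exact: sm0.
apply/trel; split; last by rewrite (linearB G) (linearP G) !Gbase subrr.
apply: smB; first exact: supp_delta.
by apply: sm_lin; exact: supp_delta.
Qed.

Let injective_stage (s : stage) := forall G : {linear V -> C},
  (forall x, sm_supp R (st_gen s) x -> phi (G x) = phi (fm_lift k x)) ->
  (forall x, st_rel s x -> G x = 0) ->
  forall x, sm_supp R (st_gen s) x -> G x = 0 -> st_rel s x.

Let injective_stage_ex : exists2 s, kill_stage s & injective_stage s.
Proof.
have [s0 Qs0] := kill_init.
have [A t QA [s As] Atot tgen trel _|s Qs maxs] := stage_zorn Qs0.
  split=> [l c /tgen[r Ar rl]|c|a c c'].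
  - by apply/trel; exists r => //; have [rcomb _ _] := QA r Ar; exact: rcomb rl.
  - by apply/tgen; exists s => //; have [_ sbase _] := QA s As; exact: sbase.
  - by apply/trel; exists s => //; have [_ _ slin] := QA s As; exact: slin.
exists s => // G Gphi G0 u su Gu; apply: contrapT => nu.
have [l lE] := comb_surj u; have [scomb sbase slin] := Qs.
(* The generators labelled by [u] are all fresh, as [u] is not a relation. Adjoining them continues
   [G] onto [C] and makes [u] a relation, against maximality. *)
pose E := [set z : Z | exists c, z = KillGen l c].
have [|c|t [G' [_ [tgen trel G's G'E _]]]] := stage_extend phi_precover.1 _ Gphi G0 (E := E).
- by move=> _ [c ->] /scomb; rewrite lE.
- by right; exists (KillGen l c) => //; exists c.
have st z : st_gen s z -> st_gen t z by rewrite tgen; left.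
have suppst x : sm_supp R (st_gen s) x -> sm_supp R (st_gen t) x by move=> sx z /sx/st.
have relst x : st_rel s x -> st_rel t x.
  move=> sx; have /suppst tx := st_supp sx; apply/trel; split=> //.
  by rewrite G's ?G0 //; exact: st_supp.
have tu : st_rel t u by apply/trel; split; [exact: suppst|rewrite G's].
have Qt : kill_stage t.
  split=> [l' c|c|a c c']; last exact/relst/slin; last exact/st/sbase.
  by rewrite tgen => -[/scomb/relst//|[_ [-> _]]]; rewrite lE.
by have [_ /(_ u tu)] := maxs t Qt (conj st relst).
Qed.

(** Maps into [C] over [M] extend along [base] to maps into the final stage. An endomorphism of the
    stage over [M], followed by a map [g] back to [C], is injective by the choice of the stage,
    hence so is the endomorphism. *)
Lemma injective_precover : exists (C1 : lmodType R) (phi1 : {linear C1 -> M}),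
  is_precover (@definable R Sg) phi1 /\
  forall f : {linear C1 -> C1}, (forall x, phi1 (f x) = phi1 x) -> forall x, f x = 0 -> x = 0.
Proof.
have [s [_ sbase slin] injs] := injective_stage_ex.
have [phi1 phi1E] := stage_over s.
have suppb c : sm_supp R (st_gen s) (base c) by apply: supp_delta; exact: sbase.
have [|j jE] := @linear_ex R C (stage_mod s) (fun c => stage_pi s (base c)).
  move=> a c c'; rewrite -linearP; apply/eqP; rewrite -subr_eq0 -linearB; apply/eqP.
  apply/stage_pi_eq0; last exact: slin.
  by apply: smB => //; exact: sm_lin.
have phi1j c : phi1 (j c) = phi c by rewrite jE phi1E // /base /= fm_lift_delta.
exists (stage_mod s), phi1; split.
  split; first exact: stage_definable.
  move=> C' psi /(phi_precover.2 _ psi)[h hE]; exists (j \o h) => x.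
  by rewrite /= phi1j hE.
move=> f fphi x fx0; have [g gE] := phi_precover.2 _ phi1 (@stage_definable _ _ _ _ _ _ _ s).
have [v sv vE] := stage_surj x.
rewrite -vE; apply/stage_pi_eq0 => //; apply: (injs (g \o (f \o stage_pi s))) => //=.
- by move=> y sy; rewrite gE fphi phi1E.
- move=> y sy; have /(stage_pi_eq0 (st_supp sy)) -> := sy; by rewrite !linear0.
- by rewrite vE fx0 linear0.
Qed.

End InjectiveEndomorphisms.

Section Cover.
Variables (R : pzRingType) (Sg : set (ppsys R)) (M C : lmodType R) (phi : {linear C -> M}).
Hypothesis phi_precover : is_precover (@definable R Sg) phi.
Hypothesis phi_inj : forall f : {linear C -> C}, (forall x, phi (f x) = phi x) ->
  forall x, f x = 0 -> x = 0.

(** A generator is an element of [C] with a subset of [C] as tag, so there are more tags than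
    elements of [C]. *)
Let Z := (C * set C)%type.
Let V := freemod R Z.
Let k (z : Z) : C := z.1.
Let stage := stage Sg phi k.

Let over_stage (s : stage) (G : {linear V -> C}) :=
  (forall x, sm_supp R (st_gen s) x -> phi (G x) = phi (fm_lift k x)) /\
  (forall x, st_rel s x -> G x = 0).

(** The two clauses together embed the set of generators in [C] through any map to [C] over [M],
    which bounds the stage. *)
Let sep_stage (s : stage) :=
  (forall y z, st_gen s y -> st_gen s z -> st_rel s (fm_delta R y - fm_delta R z) -> y = z) /\
  (forall G, over_stage s G -> forall x, sm_supp R (st_gen s) x -> G x = 0 -> st_rel s x).

(* Cantor's theorem leaves room for new generators. *)
Let fresh (s : stage) G : sep_stage s -> over_stage s G ->
  exists t, forall c, ~ st_gen s (c, t).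
Proof.
move=> [sdist sinj] sG; apply: contrapT => nfresh.
have /choice[c cE] : forall t, exists c, st_gen s (c, t).
  move=> t; apply: contrapT => nt; apply: nfresh; exists t => c sct; apply: nt.
  by exists c.
pose e t := G (fm_delta R (c t, t)).
have e_inj t u : e t = e u -> t = u.
  move=> /eqP; rewrite -subr_eq0 -linearB => /eqP G0.
  suff [] : (c t, t) = (c u, u) by [].
  apply: sdist => //; apply: (sinj G) => //.
  by apply: smB; exact: supp_delta.
pose D : set C := [set x | exists2 t, e t = x & ~ t x].
have [De|De] := pselect (D (e D)); last by apply: (De); exists D.
by have [t /e_inj -> ] := De.
Qed.

Let max_stage : exists2 s, sep_stage s & forall t, sep_stage t -> stage_le s t -> stage_le t s.
Proof.
have [s0 [gen0 supp0]] := stage_empty Sg phi k.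
apply: (@stage_zorn _ _ _ _ _ _ _ sep_stage s0).
  split=> [y z|G _ x /supp0 -> _]; last exact: sm0.
  by rewrite gen0.
move=> A t QA [s As] Atot tgen trel tsupp; split=> [y z|G [Gphi G0] x].
  move=> /tgen[p Ap py] /tgen[q Aq qz] /trel[r Ar ryz].
  have [u Au [uy uz uyz]] : exists2 u, A u & [/\ st_gen u y, st_gen u z
      & st_rel u (fm_delta R y - fm_delta R z)].
    have [w Aw [wy wz]] : exists2 w, A w & st_gen w y /\ st_gen w z.
      have [[pq _]|[qp _]] := Atot p q Ap Aq; first by exists q => //; split=> //; exact: pq.
      by exists p => //; split=> //; exact: qp.
    have [[wr _]|[_ rw]] := Atot w r Aw Ar; last by exists w => //; split=> //; exact: rw.
    by exists r => //; split=> //; exact: wr.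
  by have [udist _] := QA u Au; exact: udist.
move=> /tsupp[u Au ux] Gx; apply/trel; exists u => //.
have [_ uinj] := QA u Au; apply: (uinj G) => //; split=> y uy.
  by apply: Gphi; apply/tsupp; exists u.
by apply: G0; apply/trel; exists u.
Qed.

Lemma definable_cover : is_cover (@definable R Sg) phi.
Proof.
split=> // f fphi.
have finj x y : f x = f y -> x = y.
  move=> /eqP; rewrite -subr_eq0 -linearB => /eqP/(phi_inj fphi)/eqP.
  by rewrite subr_eq0 => /eqP.
suff fsurj : forall y, exists x, f x = y.
  have [g gK] := choice fsurj; exists g => [x|y]; last exact: gK.
  by apply: finj; rewrite gK.
have [s Qs maxs] := max_stage; have [sdist sinj] := Qs.
have [psi psiE] := stage_over s.
have [g gE] := phi_precover.2 _ psi (@stage_definable _ _ _ _ _ _ _ s).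
(* Since [f] is applied last, surjectivity of [G] gives that of [f]. *)
pose G : {linear V -> C} := f \o (g \o stage_pi s).
have Gphi x : sm_supp R (st_gen s) x -> phi (G x) = phi (fm_lift k x).
  by move=> sx; rewrite /G /= fphi gE psiE.
have G0 x : st_rel s x -> G x = 0.
  by move=> sx; have /(stage_pi_eq0 (st_supp sx)) e := sx; rewrite /G /= e !linear0.
suff Gsurj c : exists2 x, sm_supp R (st_gen s) x & G x = c.
  by move=> y; have [x _ <-] := Gsurj y; exists (g (stage_pi s x)).
apply: contrapT => nc.
have [t0 t0P] := fresh Qs (conj Gphi G0).
(* Each element missed by [G] gets one generator with the fresh tag [t0]; the missed element [c]
   makes the extension proper. *)
pose E := [set z : Z | z.2 = t0 /\ ~ exists2 x, sm_supp R (st_gen s) x & G x = z.1].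
have [|d|t [G' [G'surj [tgen trel G's G'E G'phi]]]] :=
  stage_extend phi_precover.1 _ Gphi G0 (E := E).
- by move=> [d u] [/= -> _]; exact: t0P.
- have [?|nd] := pselect (exists2 x, sm_supp R (st_gen s) x & G x = d); first by left.
  by right; exists (d, t0).
have st z : st_gen s z -> st_gen t z by rewrite tgen; left.
have suppst x : sm_supp R (st_gen s) x -> sm_supp R (st_gen t) x by move=> sx z /sx/st.
have relst x : st_rel s x -> st_rel t x.
  move=> sx; have /suppst tx := st_supp sx; apply/trel; split=> //.
  by rewrite G's ?G0 //; exact: st_supp.
have Ect0 : E (c, t0) by [].
suff Qt : sep_stage t.
  have [ts _] := maxs t Qt (conj st relst).
  by apply: (t0P c); apply: ts; rewrite tgen; right.
split=> [y z ty tz /trel[_]|H [Hphi H0] x tx Hx].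
  rewrite linearB => /eqP; rewrite subr_eq0 => /eqP Gyz; move: ty tz; rewrite tgen.
  (* An old and a new generator cannot agree, since new ones name elements missed by [G]; two new
     ones share the tag [t0]. *)
  move=> -[sy|Ey] [sz|Ez].
  - apply: sdist => //; apply: (sinj G) => //.
      by apply: smB; exact: supp_delta.
    by rewrite linearB -!G's ?Gyz ?subrr //; exact: supp_delta.
  - have [_ []] := Ez; exists (fm_delta R y); first exact: supp_delta.
    by rewrite -G's ?Gyz ?G'E //; exact: supp_delta.
  - have [_ []] := Ey; exists (fm_delta R z); first exact: supp_delta.
    by rewrite -G's -?Gyz ?G'E //; exact: supp_delta.
  - move: Gyz; rewrite !G'E //; case: y Ey => y1 y2 [/= -> _]; case: z Ez => z1 z2 [/= -> _].
    by rewrite /k /= => ->.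
(* The extended module is [C] by way of [G'], so [H] becomes an endomorphism [h] of [C] over [M],
   injective by [phi_inj]. *)
have [||h hE] := @linear_factor _ _ _ _ (G' \o supp_proj R (st_gen t)) (sm_zero _)
  (H \o supp_proj R (st_gen t)).
- by move=> d; have [v tv vd] := G'surj d; exists v; rewrite /= supp_proj_id // vd subrr.
- by move=> v /= Gv; apply: H0; apply/trel; split=> //; exact: supp_projP.
have hG' v : sm_supp R (st_gen t) v -> h (G' v) = H v.
  by move=> tv; rewrite (hE v) /= supp_proj_id // subrr.
apply/trel; split=> //; apply: (phi_inj (f := h)); last by rewrite hG'.
by move=> d; have [v tv <-] := G'surj d; rewrite hG' // Hphi // G'phi.
Qed.

End Cover.

(** * Tensor products *)

Section TensorTheory.
Variables (R : pzRingType).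
Implicit Types (F : lmodType R^c) (M : lmodType R).

Lemma pure_tensorDl F M (u v : F) (m : M) :
  pure_tensor (u + v) m = pure_tensor u m + pure_tensor v m.
Proof.
rewrite /pure_tensor -raddfD; apply/eqP; rewrite -subr_eq0 -raddfB.
by apply/eqP/pi_tensor_eq0/TensorAddl.
Qed.

Lemma pure_tensorDr F M (u : F) (m p : M) :
  pure_tensor u (m + p) = pure_tensor u m + pure_tensor u p.
Proof.
rewrite /pure_tensor -raddfD; apply/eqP; rewrite -subr_eq0 -raddfB.
by apply/eqP/pi_tensor_eq0/TensorAddr.
Qed.

Lemma pure_tensorZ F M (u : F) (r : R) (m : M) :
  pure_tensor ((r : R^c) *: u) m = pure_tensor u (r *: m).
Proof.
rewrite /pure_tensor; apply/eqP; rewrite -subr_eq0 -raddfB.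
by apply/eqP/pi_tensor_eq0/TensorBal.
Qed.

Lemma pure_tensor0r F M (u : F) : pure_tensor u (0 : M) = 0.
Proof. by apply: (addrI (pure_tensor u 0)); rewrite -pure_tensorDr !addr0. Qed.

Lemma pure_tensor0l F M (m : M) : pure_tensor (0 : F) m = 0.
Proof. by apply: (addrI (pure_tensor 0 m)); rewrite -pure_tensorDl !addr0. Qed.

Lemma pure_tensor_suml F M (m : M) n (g : nat -> F) :
  pure_tensor (\sum_(i < n) g i) m = \sum_(i < n) pure_tensor (g i) m.
Proof.
elim: n => [|n IH]; first by rewrite !big_ord0 pure_tensor0l.
by rewrite !big_ord_recr /= pure_tensorDl IH.
Qed.

Lemma tensor_ext F M (A : zmodType) (f g : tensor F M -> A) :
  zmod_morphism f -> zmod_morphism g ->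
  (forall u m, f (pure_tensor u m) = g (pure_tensor u m)) -> f =1 g.
Proof.
move=> fB gB fg t; rewrite -[t]reprK; move: (repr t) => v.
pose f' : {additive _ -> _} := HB.pack f (GRing.isZmodMorphism.Build _ _ f fB).
pose g' : {additive _ -> _} := HB.pack g (GRing.isZmodMorphism.Build _ _ g gB).
pose U (x : freemod int (F * M)%type) := f' (\pi_(tensor F M)%qT x) = g' (\pi_(tensor F M)%qT x).
have U0 : U 0 by rewrite /U !raddf0.
have Ulin (a : int) x y : U x -> U y -> U (a *: x + y).
  by rewrite /U -[a]intz scaler_int => Ux Uy; rewrite !raddfD !raddfMz Ux Uy.
have := @fm_span _ _ (Submod U0 Ulin) v; apply=> -[u m] _; exact: fg.
Qed.

Lemma tensor_lift F M (A : zmodType) (b : F -> M -> A) :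
  (forall u v m, b (u + v) m = b u m + b v m) ->
  (forall u m p, b u (m + p) = b u m + b u p) ->
  (forall u (r : R) m, b ((r : R^c) *: u) m = b u (r *: m)) ->
  exists f : {additive tensor F M -> A}, forall u m, f (pure_tensor u m) = b u m.
Proof.
move=> bDl bDr bZ.
(* The group [A] is viewed as a module over the integers, so that the universal property of the free
   module applies. *)
pose B : {linear freemod int (F * M)%type -> zmodule A} :=
  fm_lift (fun p : F * M => b p.1 p.2 : zmodule A).
have Bd u m : B (fm_delta int (u, m)) = b u m by rewrite /B /= fm_lift_delta.
have B0 x : x \in gen_zmod_pred (@tensor_rel R F M) -> B x = 0.
  move=> /asboolP/(_ (ker_pred B)) hx; apply/eqP; apply: hx => y hy.
  apply/eqP; suff : B y = 0 by [].
  case: hy => [u v m|u m p|u r m].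
  - by rewrite (linearB B) (linearD B) !Bd bDl subrr.
  - by rewrite (linearB B) (linearD B) !Bd bDr subrr.
  - by rewrite (linearB B) !Bd bZ subrr.
pose f (t : tensor F M) : A := B (repr t).
have fpi x : f (\pi_(tensor F M)%qT x) = B x.
  by apply/eqP; rewrite -subr_eq0 -raddfB; apply/eqP/B0; rewrite Quotient.idealrBE reprK.
have fB : zmod_morphism f.
  by move=> x y; rewrite -[x]reprK -[y]reprK -raddfB !fpi; exact: raddfB.
pose f' : {additive _ -> _} := HB.pack f (GRing.isZmodMorphism.Build _ _ f fB).
by exists f' => u m; rewrite /= fpi Bd.
Qed.

Definition exact_tensor (A B C : lmodType R^c) (d1 : {linear A -> B}) (d0 : {linear B -> C})
    (M : lmodType R) : Prop :=
  forall t, tensor_map d0 M t = 0 -> exists w, tensor_map d1 M w = t.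

(** [homology] divides the kernel by its intersection with the image, so it vanishes when the kernel
    is contained in the image. *)
Lemma Tor1_eq0 (F : lmodType R^c) (M : lmodType R) :
  (forall t : Tor1 F M, t = 0) <-> exact_tensor (free_res_d F 1) (free_res_d F 0) M.
Proof.
split=> [T0 t dt|ex t].
  have tker : t \in ker_pred (tensor_map (free_res_d F 0) M) by apply/eqP.
  pose z : ker (tensor_map (free_res_d F 0) M) := Ker tker.
  have /eqP := T0 (\pi_(Tor1 F M)%qT z).
  by rewrite -(raddf0 \pi_(Tor1 F M)%qT) -Quotient.idealrBE subr0 => /asboolP.
rewrite -[t]reprK -(raddf0 \pi_(Tor1 F M)%qT); apply/eqP.
rewrite -Quotient.idealrBE subr0; apply/asboolP/ex/eqP; exact: (valP (repr t)).
Qed.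

(** For a cycle [t], [g1 t] is a cycle, hence [dA1 w] for some [w]; the homotopy then gives
    [t = dB1 (f2 w + h1 t)]. *)
Lemma exact_tensor_homotopy (A2 A1 A0 B2 B1 B0 : lmodType R^c)
    (dA1 : {linear A2 -> A1}) (dA0 : {linear A1 -> A0})
    (dB1 : {linear B2 -> B1}) (dB0 : {linear B1 -> B0})
    (f2 : {linear A2 -> B2}) (f1 : {linear A1 -> B1})
    (g1 : {linear B1 -> A1}) (g0 : {linear B0 -> A0})
    (h0 : {linear B0 -> B1}) (h1 : {linear B1 -> B2}) M :
  (forall x, dB1 (f2 x) = f1 (dA1 x)) -> (forall x, dA0 (g1 x) = g0 (dB0 x)) ->
  (forall b, f1 (g1 b) + dB1 (h1 b) + h0 (dB0 b) = b) ->
  exact_tensor dA1 dA0 M -> exact_tensor dB1 dB0 M.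
Proof.
move=> df dg homot exA t dt.
have [|w dw] := exA (tensor_map g1 M t).
  have -> : tensor_map dA0 M (tensor_map g1 M t) = tensor_map g0 M (tensor_map dB0 M t).
    apply: (@tensor_ext _ _ _ (tensor_map dA0 M \o tensor_map g1 M)
                              (tensor_map g0 M \o tensor_map dB0 M)) => [x y|x y|u m] /=.
    - by rewrite !raddfB.
    - by rewrite !raddfB.
    - by rewrite !tensor_map_pure dg.
  by rewrite dt raddf0.
exists (tensor_map f2 M w + tensor_map h1 M t); rewrite raddfD /=.
have -> : tensor_map dB1 M (tensor_map f2 M w) = tensor_map f1 M (tensor_map dA1 M w).
  apply: (@tensor_ext _ _ _ (tensor_map dB1 M \o tensor_map f2 M)
                            (tensor_map f1 M \o tensor_map dA1 M)) => [x y|x y|u m] /=.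
  - by rewrite !raddfB.
  - by rewrite !raddfB.
  - by rewrite !tensor_map_pure df.
rewrite dw -[LHS]addr0 -[X in _ + X](raddf0 (tensor_map h0 M)) -dt.
apply: (@tensor_ext _ _ _ (fun t => tensor_map f1 M (tensor_map g1 M t) +
  tensor_map dB1 M (tensor_map h1 M t) + tensor_map h0 M (tensor_map dB0 M t)) id)
    => [x y|x y|u m] //=.
- by rewrite !raddfB !opprD [in RHS]addrACA [in X in _ = X + _]addrACA.
- by rewrite !tensor_map_pure -!pure_tensorDl homot.
Qed.

End TensorTheory.

(** * Projective resolutions *)

Section Projectives.
Variable S : pzRingType.

Lemma projective_freemod (K : choiceType) : projective (freemod S K).
Proof.
move=> A B g h gsurj; have /choice[a aE] : forall k, exists a, g a = h (fm_delta S k).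
  by move=> k; exact: gsurj.
exists (fm_lift a) => x; apply: (@fm_ext S K _ (g \o fm_lift a) h) => k.
by rewrite /= fm_lift_delta aE.
Qed.

(** Both maps are corestricted to the kernel of [d'], onto which [d] is surjective by exactness. *)
Lemma projective_lift (P A B C : lmodType S) (d : {linear A -> B}) (d' : {linear B -> C})
    (f : {linear P -> B}) :
  projective P -> exact_at d d' -> (forall x, d' (f x) = 0) ->
  exists k : {linear P -> A}, forall x, d (k x) = f x.
Proof.
move=> projP dd' d'f.
have corestrict (Q : lmodType S) (g : {linear Q -> B}) : (forall x, d' (g x) = 0) ->
    exists g' : {linear Q -> ker d'}, forall x, val (g' x) = g x.
  move=> d'g; have kerg x : g x \in ker_pred d' by apply/eqP.
  have [|g' g'E] := @linear_ex S Q (ker d') (fun x => Ker (kerg x)).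
    by move=> a x y; apply: val_inj; rewrite /= linearP.
  by exists g' => x; rewrite g'E.
have [f' f'E] := corestrict _ f d'f.
have [|dk dkE] := corestrict _ d; first by move=> x; apply/dd'; exists x.
have [|k kE] := projP _ _ dk f'.
  move=> y; have /dd'[x dx] : d' (val y) = 0 by apply/eqP; exact: (valP y).
  by exists x; apply: val_inj; rewrite dkE.
by exists k => x; rewrite -dkE kE f'E.
Qed.

Record resolution2 (F P0 P1 P2 : lmodType S) (e : {linear P0 -> F})
    (d0 : {linear P1 -> P0}) (d1 : {linear P2 -> P1}) : Prop := Resolution2 {
  res_proj0 : projective P0; res_proj1 : projective P1; res_proj2 : projective P2;
  res_surj : is_surj e; res_exact0 : exact_at d0 e; res_exact1 : exact_at d1 d0 }.

Lemma resolution_comparison (F P0 P1 P2 Q0 Q1 Q2 : lmodType S)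
    (e : {linear P0 -> F}) (d0 : {linear P1 -> P0}) (d1 : {linear P2 -> P1})
    (e' : {linear Q0 -> F}) (d0' : {linear Q1 -> Q0}) (d1' : {linear Q2 -> Q1}) :
  resolution2 e d0 d1 -> resolution2 e' d0' d1' ->
  exists (f0 : {linear P0 -> Q0}) (f1 : {linear P1 -> Q1}) (f2 : {linear P2 -> Q2}),
    [/\ forall x, e' (f0 x) = e x, forall x, d0' (f1 x) = f0 (d0 x)
      & forall x, d1' (f2 x) = f1 (d1 x)].
Proof.
move=> [p0 p1 p2 _ ex0 ex1] [_ _ _ surj' ex0' ex1'].
have ed x : e (d0 x) = 0 by apply/ex0; exists x.
have dd x : d0 (d1 x) = 0 by apply/ex1; exists x.
have [f0 f0E] := p0 _ _ e' e surj'.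
have [|f1 f1E] := projective_lift (f := f0 \o d0) p1 ex0'.
  by move=> x; rewrite /= f0E.
have [|f2 f2E] := projective_lift (f := f1 \o d1) p2 ex1'.
  by move=> x; rewrite /= f1E /= dd linear0.
by exists f0, f1, f2.
Qed.

(** [h0] lifts [1 - u0]; then [1 - u1 - h0 d0] is killed by [d0] and lifts to [h1]. *)
Lemma resolution_homotopy (F Q0 Q1 Q2 : lmodType S)
    (e : {linear Q0 -> F}) (d0 : {linear Q1 -> Q0}) (d1 : {linear Q2 -> Q1})
    (u0 : {linear Q0 -> Q0}) (u1 : {linear Q1 -> Q1}) :
  resolution2 e d0 d1 -> (forall x, e (u0 x) = e x) -> (forall x, d0 (u1 x) = u0 (d0 x)) ->
  exists (h0 : {linear Q0 -> Q1}) (h1 : {linear Q1 -> Q2}),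
    forall x, u1 x + d1 (h1 x) + h0 (d0 x) = x.
Proof.
move=> [p0 p1 _ _ ex0 ex1] eu du.
have [|v0 v0E] := @linear_ex S Q0 Q0 (fun x => x - u0 x).
  by move=> a x y; rewrite linearP opprD addrACA -scalerBr.
have [|h0 h0E] := projective_lift (f := v0) p0 ex0.
  by move=> x; rewrite v0E linearB eu subrr.
have [|v1 v1E] := @linear_ex S Q1 Q1 (fun x => x - u1 x - h0 (d0 x)).
  move=> a x y; rewrite (linearP u1) (linearP d0) (linearP h0) !scalerBr !opprD.
  by rewrite [X in X + _ = _]addrACA [LHS]addrACA.
have [|h1 h1E] := projective_lift (f := v1) p1 ex1.
  by move=> x; rewrite v1E !linearB /= h0E v0E du subrr.
by exists h0, h1 => x; rewrite h1E v1E -addrA subrK addrC subrK.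
Qed.

Lemma free_res_exact (F : lmodType S) i :
  exact_at (free_res_d F i) (fm_cover (syzygy F i)).
Proof.
move=> b; split=> [b0|[a <-]]; last first.
  exact/eqP/(valP (fm_cover (syzygy F i.+1) a)).
have kb : b \in ker_pred (fm_cover (syzygy F i)) by apply/eqP.
exists (fm_delta S (Ker kb)); rewrite /free_res_d /=.
by rewrite fm_lift_delta.
Qed.

Lemma free_resolution2 (F : lmodType S) :
  resolution2 (fm_cover F) (free_res_d F 0) (free_res_d F 1).
Proof.
split; try exact: projective_freemod.
- by move=> x; exists (fm_delta S x); rewrite /fm_cover /= fm_lift_delta.
- exact: free_res_exact.
move=> b; rewrite -(@free_res_exact F 1 b); split=> [b0|b0].
  by apply: val_inj.
by rewrite /free_res_d /= -[fm_lift _ b]/(fm_cover (syzygy F 1) b) b0.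
Qed.

(** The coordinates come from a section of the surjection from the free module on the generators.
    Indices are natural numbers, with value zero from [n] on. *)
Lemma dual_basis (P : lmodType S) : fin_gen P -> projective P ->
  exists (n : nat) (g : nat -> P) (s : nat -> P -> S),
    [/\ forall i u v, s i (u + v) = s i u + s i v, forall i a u, s i (a *: u) = a * s i u
      & forall u, u = \sum_(i < n) s i u *: g i].
Proof.
move=> [n [g gP]] projP; pose G : {linear freemod S 'I_n -> P} := fm_lift g.
have GE x : G x = \sum_(i < n) (fm_val x i : S) *: g i.
  have [|H HE] := @linear_ex S (freemod S 'I_n) P (fun x => \sum_(i < n) (fm_val x i : S) *: g i).
    move=> a y z; rewrite scaler_sumr -big_split; apply: eq_bigr => i _ /=.
    by rewrite [X in X *: _](_ : _ = a * fm_val y i + fm_val z i) // scalerDl scalerA.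
  rewrite -HE; apply: fm_ext => k; rewrite HE /G /= fm_lift_delta.
  rewrite (bigD1 k) //= eqxx scale1r big1 ?addr0 // => i /negPf ik.
  by rewrite ik scale0r.
have [|j jE] := projP _ _ G idfun.
  move=> u; have [c ->] := gP u; exists (\sum_(i < n) c i *: fm_delta S i).
  by rewrite linear_sum; apply: eq_bigr => i _; rewrite linearZ /G /= fm_lift_delta.
exists n, (fun i => oapp g 0 (insub i)), (fun i u => oapp (fm_val (j u)) 0 (insub i)).
split=> [i u v|i a u|u].
- by rewrite linearD; case: insubP => [k _ _|_] /=; rewrite ?addr0.
- by rewrite linearZ; case: insubP => [k _ _|_] /=; rewrite ?mulr0.
rewrite -[LHS]jE GE; apply: eq_bigr => i _.
by rewrite valK.
Qed.

End Projectives.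

(** * Definability of flatness *)

Lemma exact_tensor_resolution (R : pzRingType) (F P0 P1 P2 Q0 Q1 Q2 : lmodType R^c)
    (e : {linear P0 -> F}) (d0 : {linear P1 -> P0}) (d1 : {linear P2 -> P1})
    (e' : {linear Q0 -> F}) (d0' : {linear Q1 -> Q0}) (d1' : {linear Q2 -> Q1})
    (M : lmodType R) :
  resolution2 e d0 d1 -> resolution2 e' d0' d1' ->
  exact_tensor d1 d0 M -> exact_tensor d1' d0' M.
Proof.
move=> rP rQ; have [f0 [f1 [f2 [ef0 df1 df2]]]] := resolution_comparison rP rQ.
have [g0 [g1 [_ [eg0 dg1 _]]]] := resolution_comparison rQ rP.
have [||h0 [h1 hE]] := @resolution_homotopy _ _ _ _ _ _ _ _ (f0 \o g0) (f1 \o g1) rQ.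
- by move=> x; rewrite /= ef0.
- by move=> x; rewrite /= df1 dg1.
exact: (exact_tensor_homotopy df2 dg1 hE).
Qed.

Section DualBasis.
Variables (R : pzRingType) (P : lmodType R^c) (n : nat) (g : nat -> P) (s : nat -> P -> R^c).
Hypothesis sD : forall i u v, s i (u + v) = s i u + s i v.
Hypothesis sZ : forall i a u, s i (a *: u) = a * s i u.
Hypothesis sg : forall u, u = \sum_(i < n) s i u *: g i.
Variable M : lmodType R.

Definition dual_comb (x : nat -> M) : tensor P M := \sum_(i < n) pure_tensor (g i) (x i).

Lemma dual_coord : exists c : nat -> {additive tensor P M -> M},
  (forall i u m, c i (pure_tensor u m) = (s i u : R) *: m) /\
  (forall t, dual_comb (fun i => c i t) = t).
Proof.
have /choice[c cE] : forall i, exists c : {additive tensor P M -> M},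
    forall u m, c (pure_tensor u m) = (s i u : R) *: m.
  move=> i; apply: tensor_lift => [u v m|u m p|u r m].
  - by rewrite sD scalerDl.
  - by rewrite scalerDr.
  (* The product of [R^c] is reversed in [R], which is the order that the balancing relation
     needs. *)
  - by rewrite sZ scalerA.
exists c; split=> //; apply: tensor_ext => // [x y|u m].
  rewrite /dual_comb -sumrB; apply: eq_bigr => i _.
  by rewrite raddfB; apply/eqP; rewrite eq_sym subr_eq -pure_tensorDr subrK.
rewrite [in RHS](sg u) (pure_tensor_suml m n (fun i => s i u *: g i)).
by apply: eq_bigr => i _; rewrite cE pure_tensorZ.
Qed.

Lemma tensor_map_dual_comb (Q : lmodType R^c) (d : {linear P -> Q}) (x : nat -> M) :
  tensor_map d M (dual_comb x) = \sum_(i < n) pure_tensor (d (g i)) (x i).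
Proof. by rewrite raddf_sum; apply: eq_bigr => i _; exact: tensor_map_pure. Qed.

End DualBasis.

(* With finite dual bases, the middle homology of P2 (x) M -> P1 (x) M -> P0 (x) M
   is computed on tuples of elements of M.  A tuple x comes from a cycle when it
   satisfies the equations d0 x = 0 (indices j < n0) and p x = x (the other ones),
   where p is the projector of R^n1 onto P1. *)
Lemma exact_tensor_ppsys (R : pzRingType) (P0 P1 P2 : lmodType R^c)
    (d0 : {linear P1 -> P0}) (d1 : {linear P2 -> P1}) :
  fin_gen P0 /\ projective P0 -> fin_gen P1 /\ projective P1 ->
  fin_gen P2 /\ projective P2 ->
  exists s : ppsys R, forall M : lmodType R,
    exact_tensor d1 d0 M <-> solv (sm_full M) (sm_zero M) s.
Proof.
move=> [fg0 pr0] [fg1 pr1] [fg2 pr2].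
have [n0 [g0 [s0 [s0D s0Z s0g]]]] := dual_basis fg0 pr0.
have [n1 [g1 [s1 [s1D s1Z s1g]]]] := dual_basis fg1 pr1.
have [n2 [g2 [s2 [s2D s2Z s2g]]]] := dual_basis fg2 pr2.
exists (@PPsys R n1 (n0 + n1) n2
  (fun j i => if (j < n0)%N then s0 j (d0 (g1 i))
              else (s1 (j - n0)%N (g1 i) : R) - (i == j - n0)%N%:R)
  (fun i l => s1 i (d1 (g2 l)))) => M; set S := PPsys _ _ _ _ _.
have [c0 [c0E c0K]] := dual_coord s0D s0Z s0g M.
have [c1 [c1E c1K]] := dual_coord s1D s1Z s1g M.
have [c2 [_ c2K]] := dual_coord s2D s2Z s2g M.
have lhs0 x j : (j < n0)%N -> pp_lhs S x j = c0 j (tensor_map d0 M (dual_comb n1 g1 x)).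
  move=> jn; rewrite tensor_map_dual_comb raddf_sum; apply: eq_bigr => i _.
  by rewrite c0E /= jn.
have lhs1 x j : (j < n1)%N -> pp_lhs S x (n0 + j) = c1 j (dual_comb n1 g1 x) - x j.
  move=> jn; rewrite /pp_lhs /= ltnNge leq_addr /= addKn raddf_sum /=.
  under eq_bigr do rewrite scalerBl.
  rewrite sumrB; congr (_ - _).
    by apply: eq_bigr => i _; rewrite c1E.
  rewrite (bigD1 (Ordinal jn)) //= eqxx scale1r big1 ?addr0 // => i.
  by rewrite -val_eqE /= => /negPf ->; rewrite scale0r.
have rhsE y i : pp_rhs S y i = c1 i (tensor_map d1 M (dual_comb n2 g2 y)).
  by rewrite tensor_map_dual_comb raddf_sum; apply: eq_bigr => l _; rewrite c1E.
have comb0 n (P : lmodType R^c) (g : nat -> P) (x : nat -> M) :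
    (forall i, (i < n)%N -> x i = 0) -> dual_comb n g x = 0.
  by move=> x0; rewrite /dual_comb big1 // => i _; rewrite x0 // pure_tensor0r.
have combE n (P : lmodType R^c) (g : nat -> P) (x y : nat -> M) :
    (forall i, (i < n)%N -> x i = y i) -> dual_comb n g x = dual_comb n g y.
  by move=> xy; apply: eq_bigr => i _; rewrite xy.
split=> [exM x _ x0|sol t dt].
  have x1 i : (i < n1)%N -> x i = c1 i (dual_comb n1 g1 x).
    move=> ilt; have := x0 (n0 + i)%N; rewrite /= ltn_add2l => /(_ ilt).
    by rewrite lhs1 // => /eqP; rewrite subr_eq0 => /eqP.
  have [|w wE] := exM (dual_comb n1 g1 x).
    rewrite -[LHS]c0K; apply: comb0 => j jn; rewrite -lhs0 //.
    by apply: x0; rewrite /= ltn_addr.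
  exists (fun l => c2 l w) => // i ilt /=.
  by rewrite rhsE c2K wE -x1 // subrr.
have [//|j jn|y _ yP] := sol (fun i => c1 i t).
  have [j0|j0] := ltnP j n0; first by rewrite /= lhs0 // c1K dt raddf0.
  rewrite -(subnKC j0) /= lhs1 ?c1K ?subrr //.
  by rewrite ltn_subLR.
exists (dual_comb n2 g2 y); rewrite -[RHS]c1K -[LHS]c1K; apply: combE => i ilt.
by have /eqP := yP i ilt; rewrite subr_eq0 rhsE => /eqP.
Qed.

Lemma FP_fin_presented2 (S : pzRingType) (n : level) (M : lmodType S) :
  level_gt1 n -> FP n M -> exists2 k, (1 < k)%N & fin_presented k M.
Proof. by case: n => [k k1 Mk|_ MFP]; [exists k|exists 2]. Qed.

(** As [n > 1], finitely generated projectives are available in degrees 0, 1 and 2. Comparison of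
    resolutions lets them replace the canonical free resolution. *)
Lemma Tor1_ppsys (R : pzRingType) (n : level) (F : lmodType R^c) :
  level_gt1 n -> FP n F -> exists s : ppsys R, forall M : lmodType R,
    (forall t : Tor1 F M, t = 0) <-> solv (sm_full M) (sm_zero M) s.
Proof.
move=> n1 /(FP_fin_presented2 n1)[k k1 [P [d [e [Pfp esurj de dd]]]]].
have k0 : (0 < k)%N by exact: ltnW.
have rP : resolution2 e (d 0) (d 1).
  by split; [apply: (Pfp _ _).2|apply: (Pfp _ _).2|apply: (Pfp _ _).2| |apply: de|apply: dd].
have [s sP] := exact_tensor_ppsys (d 0) (d 1) (Pfp 0 isT) (Pfp 1 k0) (Pfp 2 k1).
exists s => M; apply: (iff_trans _ (sP M)); apply: (iff_trans (Tor1_eq0 F M)).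
split; first exact: (exact_tensor_resolution (free_resolution2 F) rP).
exact: (exact_tensor_resolution rP (free_resolution2 F)).
Qed.

Lemma FP_flat_definable (R : pzRingType) (n : level) : level_gt1 n ->
  exists Sg : set (ppsys R), @FP_flat R n = definable Sg.
Proof.
(* Although [F] ranges over all modules in [FP n], the systems that detect its [Tor1] form a subset
   of [ppsys R]; no set of representatives is chosen. *)
move=> n1; exists [set s | exists2 F : lmodType R^c, FP n F & forall M : lmodType R,
  (forall t : Tor1 F M, t = 0) <-> solv (sm_full M) (sm_zero M) s].
apply/funext => M; apply/propext; split=> [flatM s [F /flatM FM sF]|defM F FPF].
  exact/sF.
have [s sF] := Tor1_ppsys n1 FPF; apply/sF/defM; by exists F.
Qed.

Lemma definable_covering (R : pzRingType) (Sg : set (ppsys R)) : covering (@definable R Sg).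
Proof.
move=> M; have [C [phi preC]] := definable_precover Sg M.
have [C1 [phi1 [preC1 injC1]]] := injective_precover preC.
by exists C1, phi1; exact: definable_cover.
Qed.

Theorem proposition3p3 (R : pzRingType) (n : level) (hn : level_gt1 n) :
  covering (@FP_flat R n) /\ preenveloping (@FP_flat R n).
Proof.
have [Sg ->] := FP_flat_definable R hn; split; first exact: definable_covering.
by move=> M; exact: definable_preenvelope.
Qed.
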